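(* Let $N \ge 2$ and $1^* = \frac{N}{N-1}$. Let $BV_{rad}(\mathbb{R}^N) = \{u \in BV(\mathbb{R}^N) : u(x) = u(|x|)\}$ be the subspace of radially symmetric functions of $BV(\mathbb{R}^N)$, endowed with the norm of $BV(\mathbb{R}^N)$. Then the embedding $$BV_{rad}(\mathbb{R}^N) \hookrightarrow L^q(\mathbb{R}^N)$$ is compact for every $1 < q < 1^*$.
   Context: $BV(\mathbb{R}^N)$ is the space of functions of bounded variation: all $u \in L^1(\mathbb{R}^N)$ whose distributional derivative $Du$ is a (finite) vector-valued Radon measure, equivalently $$\int_{\mathbb{R}^N}|Du| := \sup\left\{\int_{\mathbb{R}^N} u\,\mathrm{div}\,\phi\,dx : \phi \in C^1_c(\mathbb{R}^N,\mathbb{R}^N),\ |\phi|_\infty \le 1\right\} < +\infty.$$ It is a Banach space with the norm $\|u\| = \int_{\mathbb{R}^N}|Du| + \int_{\mathbb{R}^N}|u|\,dx$. The notation $u(x)=u(|x|)$ means that $u$ depends (almost everywhere) only on $|x|$. *)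

(* Defs.v *)
From HB Require Import structures.
From mathcomp Require Import all_boot all_order all_algebra.
From mathcomp Require Import all_classical all_reals all_analysis.

Set Implicit Arguments.
Unset Strict Implicit.
Unset Printing Implicit Defensive.

Import Order.TTheory GRing.Theory Num.Theory.
Import numFieldNormedType.Exports.

Local Open Scope classical_set_scope.
Local Open Scope ring_scope.

(* Row vectors carry the product sigma-algebra, generated by the coordinate
   maps; it is the Borel sigma-algebra of the library's topology on 'rV[R]_n. *)
Definition rV_display : measure_display. Proof. by constructor. Qed.

Section measurable_rV.
Context {R : realType} {n : nat}.

Let coord (i : 'I_n) (x : 'rV[R]_n) : measurableTypeR R := x ord0 i.

Let rV_set0 : g_sigma_preimage coord set0.
Proof. exact: sigma_algebra0. Qed.

Let rV_setC A : g_sigma_preimage coord A -> g_sigma_preimage coord (~` A).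
Proof. exact: sigma_algebraC. Qed.

Let rV_bigcup (F : _^nat) : (forall i, g_sigma_preimage coord (F i)) ->
  g_sigma_preimage coord (\bigcup_i (F i)).
Proof. exact: sigma_algebra_bigcup. Qed.

HB.instance Definition _ := @isMeasurable.Build rV_display
  'rV[R]_n (g_sigma_preimage coord) rV_set0 rV_setC rV_bigcup.

Lemma measurable_fun_rVP d (T : measurableType d) (f : T -> 'rV[R]_n) :
  measurable_fun setT f <->
  forall i, measurable_fun setT (fun x => f x ord0 i : measurableTypeR R).
Proof.
split=> [mf i _ A mA|mf].
  rewrite setTI.
  have -> : (fun x => f x ord0 i) @^-1` A = setT `&` f @^-1` (coord i @^-1` A).
    by rewrite setTI.
  apply: mf => //; apply: sub_sigma_algebra.
  rewrite -bigcup_seq/=; exists i => /=; first by rewrite mem_index_enum.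
  by exists A => //; rewrite setTI.
move=> _ Y mY; rewrite setTI.
pose M : set (set 'rV[R]_n) := [set B | measurable (f @^-1` B)].
have : M Y; last by [].
apply: mY; split.
  split; rewrite /M/= ?preimage_set0//.
  - move=> B mB; rewrite setTD -[X in measurable X]/(~` (f @^-1` B)).
    exact: measurableC.
  - by move=> F mF; rewrite preimage_bigcup; exact: bigcupT_measurable.
rewrite -bigcup_seq => B [i _ [A mA <-]]; rewrite /M/= !setTI.
by have := mf i measurableT A mA; rewrite setTI.
Qed.

End measurable_rV.

Section cons_rV.
Context {R : realType} {n : nat}.

Definition cons_rV (p : measurableTypeR R * 'rV[R]_n) : 'rV[R]_n.+1 :=
  row_mx (p.1)%:M p.2.

Definition uncons_rV (x : 'rV[R]_n.+1) : measurableTypeR R * 'rV[R]_n :=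
  (x ord0 ord0, \row_i x ord0 (lift ord0 i)).

Lemma cons_rV0 p : cons_rV p ord0 ord0 = p.1.
Proof.
rewrite /cons_rV (_ : ord0 = lshift n (ord0 : 'I_1)); last exact/val_inj.
by rewrite (@row_mxEl _ 1 1 n) mxE mulr1n.
Qed.

Lemma cons_rVS p i : cons_rV p ord0 (lift ord0 i) = p.2 ord0 i.
Proof.
rewrite /cons_rV (_ : lift ord0 i = rshift 1 i); last exact/val_inj.
by rewrite (@row_mxEr _ 1 1 n).
Qed.

Lemma cons_rVK : cancel cons_rV uncons_rV.
Proof.
move=> p; rewrite /uncons_rV cons_rV0 [RHS]surjective_pairing; congr pair.
by apply/rowP => i; rewrite mxE cons_rVS.
Qed.

Lemma uncons_rVK : cancel uncons_rV cons_rV.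
Proof.
move=> x; apply/rowP => i; rewrite -[0]/ord0.
have [->|] := eqVneq i ord0; first by rewrite cons_rV0.
by case: (unliftP ord0 i) => [j ->|->]; rewrite ?eqxx// cons_rVS mxE.
Qed.

Lemma measurable_cons_rV : measurable_fun setT cons_rV.
Proof.
apply/measurable_fun_rVP => i.
case: (unliftP ord0 i) => [j ->|->]; last first.
  by under eq_fun do rewrite cons_rV0; exact: measurable_fst.
under eq_fun do rewrite cons_rVS.
have /measurable_fun_rVP/(_ j) mj := @measurable_id _ 'rV[R]_n setT.
exact: (measurableT_comp mj measurable_snd).
Qed.

Lemma measurable_uncons_rV : measurable_fun setT uncons_rV.
Proof.
have /measurable_fun_rVP mx := @measurable_id _ 'rV[R]_n.+1 setT.
apply/measurable_fun_pairP; split; first exact: mx.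
apply/measurable_fun_rVP => j.
by rewrite [X in measurable_fun _ X](_ : _ = fun x : 'rV[R]_n.+1 =>
  x ord0 (lift ord0 j)) //; apply/funext => x /=; rewrite mxE.
Qed.

End cons_rV.

Section lebesgue_rV_cons.
Context {R : realType} {n : nat}.
Variable mu : {sigma_finite_measure set 'rV[R]_n -> \bar R}.

(* image of the product measure under the identification of R x R^n with
   R^(n + 1) *)
Definition lebesgue_rV_cons : set 'rV[R]_n.+1 -> \bar R :=
  pushforward (@lebesgue_measure R \x mu)%E cons_rV.

Let mc := @measurable_cons_rV R n.

Let cons0 : lebesgue_rV_cons set0 = 0%E.
Proof. by rewrite /lebesgue_rV_cons /pushforward preimage_set0 measure0. Qed.

Let cons_ge0 A : (0 <= lebesgue_rV_cons A)%E.
Proof. exact: measure_ge0. Qed.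

Let cons_sigma_additive : semi_sigma_additive lebesgue_rV_cons.
Proof.
move=> F mF tF mUF; rewrite /lebesgue_rV_cons /pushforward preimage_bigcup.
apply: measure_semi_sigma_additive.
- by move=> i; rewrite -[X in measurable X]setTI; exact: mc.
- apply/trivIsetP => /= i j _ _ ij; rewrite -preimage_setI.
  by move/trivIsetP : tF => /(_ _ _ _ _ ij) ->//; rewrite preimage_set0.
- by rewrite -preimage_bigcup -[X in measurable X]setTI; exact: mc.
Qed.

HB.instance Definition _ := isMeasure.Build _ _ _ lebesgue_rV_cons
  cons0 cons_ge0 cons_sigma_additive.

Let cons_sigma_finite : sigma_finite setT lebesgue_rV_cons.
Proof.
have /sigma_finiteP[F [TF ndF Foo]] := sigma_finiteT (@lebesgue_measure R).
have /sigma_finiteP[G [TG ndG Goo]] := sigma_finiteT mu.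
exists (fun k => uncons_rV @^-1` (F k `*` G k)).
  rewrite -preimage_bigcup (_ : \bigcup_k _ = setT) ?preimage_setT//.
  rewrite -setXTT TF TG predeqE => -[x y]; split.
    by move=> [k _ []/= ? ?]; split; exists k.
  move=> [/= [k _ Fkx] [l _ Gly]]; exists (maxn k l) => //; split.
  - by move: x Fkx; exact/subsetPset/ndF/leq_maxl.
  - by move: y Gly; exact/subsetPset/ndG/leq_maxr.
move=> k; have [mF Fk] := Foo k; have [mG Gk] := Goo k; split.
  rewrite -[X in measurable X]setTI.
  by apply: measurable_uncons_rV => //; exact: measurableX.
rewrite /lebesgue_rV_cons /pushforward -comp_preimage.
rewrite (_ : _ \o _ = id) ?preimage_id; last first.
  by apply/funext => p /=; rewrite cons_rVK.
by rewrite product_measure1E// lte_mul_pinfty// ge0_fin_numE.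
Qed.

HB.instance Definition _ := Measure_isSigmaFinite.Build _ _ _ lebesgue_rV_cons
  cons_sigma_finite.

End lebesgue_rV_cons.

Fixpoint lebesgue_rV (R : realType) (n : nat) :
    {sigma_finite_measure set 'rV[R]_n -> \bar R} :=
  match n with
  | 0 => dirac (0 : 'rV[R]_0)
  | m.+1 => lebesgue_rV_cons (lebesgue_rV R m)
  end.
Arguments lebesgue_rV {R n}.

Lemma lebesgue_rV_box (R : realType) n (A : 'I_n -> set (measurableTypeR R)) :
  (forall i, measurable (A i)) ->
  lebesgue_rV [set x : 'rV[R]_n | forall i, A i (x ord0 i)] =
  (\prod_(i < n) lebesgue_measure (A i))%E.
Proof.
elim: n A => [|n ih] A mA.
  by rewrite big_ord0 /= diracE mem_set// => -[].
rewrite big_ord_recl -ih//= /lebesgue_rV_cons /pushforward.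
have -> : cons_rV @^-1` [set x : 'rV[R]_n.+1 | forall i, A i (x ord0 i)] =
    A ord0 `*` [set x : 'rV[R]_n | forall i, A (lift ord0 i) (x ord0 i)].
  apply/seteqP; split=> [p /= Ap|p [/= A0 AS] i].
    by split=> [|i]; [have := Ap ord0; rewrite cons_rV0|
                      have := Ap (lift ord0 i); rewrite cons_rVS].
  by case: (unliftP ord0 i) => [j ->|->]; rewrite ?cons_rV0 ?cons_rVS.
rewrite product_measure1E//.
rewrite (_ : mkset _ = \bigcap_(i in setT) ((fun x : 'rV[R]_n =>
    x ord0 i : measurableTypeR R) @^-1` A (lift ord0 i))); last first.
  by apply/seteqP; split=> [x Ax i _|x Ax i]; [exact: Ax|exact: (Ax i I)].
apply: fin_bigcap_measurable => // i _.
have /measurable_fun_rVP/(_ i) mi := @measurable_id _ 'rV[R]_n setT.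
by rewrite -[X in measurable X]setTI; exact: mi.
Qed.

Section bounded_variation.
Context {R : realType} {N : nat}.
Implicit Types (u f : 'rV[R]_N -> R) (phi : 'rV[R]_N -> 'rV[R]_N).

Local Notation mu := (@lebesgue_rV R N).

(* Euclidean norm: the library's `|x| on 'rV[R]_N is the sup norm *)
Definition enorm (x : 'rV[R]_N) : R := Num.sqrt (\sum_i x ord0 i ^+ 2).

Definition is_C1 f := forall j : 'I_N,
  (forall x, derivable f x (delta_mx 0 j)) /\
  continuous (fun x => 'D_(delta_mx 0 j) f x).

Definition divergence phi (x : 'rV[R]_N) : R :=
  \sum_(i < N) 'D_(delta_mx 0 i) (fun y => phi y ord0 i) x.

Definition C1c_field : set ('rV[R]_N -> 'rV[R]_N) :=
  [set phi | (forall i : 'I_N, is_C1 (fun x => phi x ord0 i)) /\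
             compact (closure [set x | phi x != 0])].

(* the total mass \int |Du| of the distributional derivative of u *)
Definition bv_variation u : \bar R :=
  ereal_sup [set (\int[mu]_x (u x * divergence phi x)%:E)%E |
    phi in [set phi | C1c_field phi /\ forall x, enorm (phi x) <= 1]].

(* As in Lfun, elements are functions rather than classes of a.e. equal
   functions; everything below is invariant under a.e. equality. *)
Definition BV : set ('rV[R]_N -> R) :=
  [set u | u \in Lfun mu 1 /\ (bv_variation u < +oo)%E].

Definition BV_norm u : \bar R :=
  (bv_variation u + 'N[mu]_1[EFin \o u])%E.

Definition BV_rad : set ('rV[R]_N -> R) :=
  [set u | BV u /\
    exists g : R -> R, {ae mu, forall x, u x = g (enorm x)}].

Definition compactly_embedded (X : set ('rV[R]_N -> R))
    (nrm : ('rV[R]_N -> R) -> \bar R) (q : R) : Prop :=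
  [/\ (forall u, X u -> u \in Lfun mu q%:E),
      (exists C : R, forall u, X u ->
         ('N[mu]_q%:E[EFin \o u] <= C%:E * nrm u)%E) &
      forall u_ : ('rV[R]_N -> R)^nat,
        (forall n, X (u_ n)) ->
        (exists M : R, forall n, (nrm (u_ n) <= M%:E)%E) ->
        exists (k : nat -> nat) (v : 'rV[R]_N -> R),
          [/\ {homo k : m n / (m < n)%N}, v \in Lfun mu q%:E &
              ('N[mu]_q%:E[EFin \o (u_ (k n) \- v)%R])%E @[n --> \oo] --> 0%E]].

End bounded_variation.
Arguments BV {R N}.
Arguments BV_rad {R N}.

(* Main.v *)
Require Import Defs.
From mathcomp Require Import all_boot all_order all_algebra.
From mathcomp Require Import all_classical all_reals all_analysis.
From mathcomp Require Import measurable_realfun ring lra.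

(** Why radial functions of bounded variation embed compactly into L^q.

The volume coordinate t = |x|^N pushes Lebesgue measure on R^N forward to omega
times Lebesgue measure on (0, +oo), where omega is the volume of the unit ball
(radial_law).  Writing u(x) = G(|x|^N), every L^p norm of u is a one-dimensional
integral of G, and testing the total variation of u against the fields
x |-> K(|x|^N) x turns it into a weighted variation of G: for psi of class C^1
with |psi| <= 1 and compact support in (s, +oo),

  omega N s^a \int G psi' <= \int |Du|,   where a = (N - 1) / N = 1 / 1^*

(dual_values_variation).  So the variation of G on (s, +oo) is at most a
constant times s^(-a) \int |Du|.  Since G is integrable it is small somewhere
near infinity, hence |G(t)| <= C t^(-a) ||u|| almost everywhere
(BV_rad_profile).

This pointwise decay controls |G|^q at both ends of (0, +oo).  Near 0 it is
bounded by a multiple of t^(-a q), which is integrable because q < 1^* means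
a q < 1.  Near infinity |G|^q <= (C T^(-a))^(q - 1) |G| on (T, +oo), which has a
small integral, uniformly on bounded sets, because q > 1.  The embedding is
therefore continuous (BV_rad_Lnorm_le).

For compactness, a bounded sequence in BV_rad has profiles of uniformly bounded
variation on every (s, +oo), and Helly's selection principle (helly) gives a
subsequence that converges almost everywhere.  Dominated convergence near 0 and
the uniform smallness near infinity upgrade this to convergence in L^q
(decaying_vanish).

The variation of G on (s, +oo) is handled by duality throughout
(tail_variation).  Its link with pointwise values is tail_variation_drop: at
Lebesgue points s < t of G, adding to a test function supported beyond t a
smoothed indicator of (s, t) produces the extra term |G(s) - G(t)|. *)

Set Implicit Arguments.
Unset Strict Implicit.
Unset Printing Implicit Defensive.

Import Order.TTheory GRing.Theory Num.Theory.
Import numFieldNormedType.Exports.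
Local Open Scope classical_set_scope.
Local Open Scope ring_scope.

(** * Quadratic splines and averages at Lebesgue points *)

Section spline.
Context {R : realType}.
Implicit Types (x c h : R).

(** A quadratic remainder bound, valid for every increment, avoids a case
analysis at the knots of the splines below. *)
Lemma is_derive_quadratic (f : R -> R) x d C :
  (forall h, `|f (x + h) - f x - h * d| <= C * h ^+ 2) ->
  is_derive x (1 : R) f d.
Proof.
move=> fxd; suff fd : h^-1 *: (f (h *: (1:R) + x) - f x) @[h --> 0^'] --> (d : R).
  by apply: DeriveDef; [apply/cvg_ex; exists d | exact: cvg_lim].
apply/cvgrPdist_le => /= e e0; near=> h.
have h0 : h != 0 by near: h; exact: nbhs_dnbhs_neq.
have -> : d - h^-1 *: (f (h *: (1 : R) + x) - f x) =
    - h^-1 * (f (x + h) - f x - h * d).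
  rewrite /GRing.scale /= mulr1 (addrC h); field => //.
rewrite normrM normrN normfV ler_pdivrMl ?normr_gt0//.
apply: (le_trans (fxd h)); rewrite -(real_normK (num_real h)) expr2.
have Ce : `|h| * `|C| <= e.
  rewrite (@le_trans _ _ (e / (`|C| + 1) * `|C|))//.
    apply: ler_wpM2r => //; near: h.
    apply: dnbhs0_le; rewrite divr_gt0// ltr_wpDl//.
  rewrite -mulrA ler_piMr ?(ltW e0)// ler_pdivrMl ?mulr1 ?lerDl// ltr_wpDl//.
rewrite mulrC -mulrA; apply: ler_wpM2l => //.
by apply: le_trans Ce; apply: ler_wpM2l => //; exact: ler_norm.
Unshelve. all: by end_near. Qed.

Definition pospart x : R := Num.max x 0.

Lemma is_derive_pospart_sqr x :
  is_derive x (1 : R) (fun y => pospart y ^+ 2) (2 * pospart x).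
Proof.
apply: (@is_derive_quadratic _ _ _ 1) => h; rewrite mul1r ler_norml /pospart.
by case: (leP x 0) => ?; case: (leP (x + h) 0) => ?; apply/andP; split; nra.
Qed.

Lemma continuous_pospart : continuous pospart.
Proof.
move=> x; apply: (@continuous_max R R idfun (cst 0)) => //; exact: cvg_cst.
Qed.

(** The hat function of height 1/h on [c - h, c + h]: a second difference of
the positive part. *)
Definition tent c h x :=
  (pospart (x - c + h) - 2 * pospart (x - c) + pospart (x - c - h)) / h ^+ 2.

(** The primitive of [tent c h] that vanishes at -oo: a C^1 transition from 0
to 1 across [c - h, c + h]. *)
Definition step c h x :=
  (pospart (x - c + h) ^+ 2 - 2 * pospart (x - c) ^+ 2 + pospart (x - c - h) ^+ 2)
  / (2 * h ^+ 2).

Lemma is_derive_step c h x : is_derive x (1 : R) (step c h) (tent c h x).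
Proof.
have sh k : is_derive x (1 : R) (fun y => pospart (y - c + k) ^+ 2)
    (2 * pospart (x - c + k)).
  rewrite -[X in is_derive _ _ _ X]mulr1.
  apply: (@is_derive1_comp _ (fun y => pospart y ^+ 2) (fun y => y - c + k)).
    exact: is_derive_pospart_sqr.
  by apply: is_derive_eq; rewrite subr0 addr0.
have s0 := sh 0; rewrite addr0 in s0.
have {}s0 : is_derive x (1 : R) (fun y => pospart (y - c) ^+ 2)
    (2 * pospart (x - c)).
  by move: s0; under eq_fun do rewrite addr0.
have sN := sh (- h).
rewrite (_ : step c h = fun y => (2 * h ^+ 2)^-1 *: (pospart (y - c + h) ^+ 2
  - 2 *: pospart (y - c) ^+ 2 + pospart (y - c - h) ^+ 2)); last first.
  by apply/funext => y; rewrite /step mulrC.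
apply: is_derive_eq; rewrite /tent /GRing.scale /=.
have [->|h0] := eqVneq h 0; first by rewrite expr0n/= mulr0 invr0 mulr0 mul0r.
by field.
Qed.

Lemma continuous_tent c h : continuous (tent c h).
Proof.
have sh k : continuous (fun y => pospart (y - c + k)).
  move=> x; apply: (@continuous_comp _ _ _ (fun y => y - c + k)).
    by apply: cvgD; [apply: cvgB|]; [exact: cvg_id|exact: cvg_cst|exact: cvg_cst].
  exact: continuous_pospart.
have s0 : continuous (fun y => pospart (y - c)).
  by have := sh 0; under eq_fun do rewrite addr0.
move=> x; apply: cvgM; last exact: cvg_cst.
apply: cvgD; last exact: sh.
by apply: cvgB; [exact: sh|apply: cvgM; [exact: cvg_cst|exact: s0]].
Qed.

Lemma step_le c h x : 0 < h -> x <= c - h -> step c h x = 0.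
Proof.
move=> h0 xc; rewrite /step /pospart.
by rewrite !max_r; [rewrite expr0n/= mulr0 subrr addr0 mul0r|lra..].
Qed.

Lemma step_ge c h x : 0 < h -> c + h <= x -> step c h x = 1.
Proof.
move=> h0 xc; rewrite /step /pospart.
by rewrite !max_l; [field; rewrite gt_eqF|lra..].
Qed.

Lemma step_itv c h x : 0 < h -> 0 <= step c h x <= 1.
Proof.
move=> h0; rewrite /step /pospart; have h20 : 0 < 2 * h ^+ 2.
  by rewrite mulr_gt0// exprn_gt0.
rewrite ler_pdivlMr// ler_pdivrMr// mul0r mul1r.
case: (leP (x - c + h) 0) => ?; case: (leP (x - c) 0) => ?;
  case: (leP (x - c - h) 0) => ?; apply/andP; split; nra.
Qed.

Lemma tent_out c h x : 0 < h -> (x <= c - h) || (c + h <= x) -> tent c h x = 0.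
Proof.
move=> h0 /orP[] xc; rewrite /tent /pospart.
  by rewrite !max_r; [rewrite mulr0 subrr addr0 mul0r|lra..].
by rewrite !max_l; [rewrite [X in X / _](_ : _ = 0) ?mul0r//; ring|lra..].
Qed.

Lemma tent_itv c h x : 0 < h -> 0 <= tent c h x <= h^-1.
Proof.
move=> h0; rewrite /tent /pospart; have h20 : 0 < h ^+ 2 by rewrite exprn_gt0.
rewrite ler_pdivlMr// ler_pdivrMr// mul0r expr2 mulKf ?gt_eqF//.
by case: (leP (x - c + h) 0) => ?; case: (leP (x - c) 0) => ?;
  case: (leP (x - c - h) 0) => ?; apply/andP; split; lra.
Qed.

End spline.

Section test_functions.
Context {R : realType}.
Implicit Types (q : R) (G psi dpsi : R -> R).
Local Notation leb := (@lebesgue_measure R).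

(** The competitors in the dual definition of the variation of a function on
(q, +oo).  The derivative [dpsi] is carried along explicitly. *)
Definition test_fun q psi dpsi : Prop :=
  [/\ forall x, is_derive x (1 : R) psi (dpsi x), continuous dpsi,
      forall x, `|psi x| <= 1 &
      exists c d, q < c /\
        forall x, (x <= c) || (d <= x) -> psi x = 0 /\ dpsi x = 0].

Lemma test_fun_bounded q psi dpsi : test_fun q psi dpsi ->
  exists M, forall x, `|dpsi x| <= M.
Proof.
move=> [_ cd _ [c [d [_ out]]]].
have [M [_ hM]] : bounded_set (dpsi @` `[c, d]).
  apply/compact_bounded/continuous_compact; last exact: segment_compact.
  by apply: continuous_subspaceT => x; exact: cd.
exists (Num.max (M + 1) 0) => x; rewrite le_max.
have [xc|xc] := leP x c; first by rewrite (out _ _).2 ?xc// normr0 lexx orbT.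
have [dx|dx] := leP d x; first by rewrite (out _ _).2 ?dx ?orbT// normr0 lexx orbT.
rewrite (hM (M + 1))//; first by rewrite ltrDl.
by exists x => //=; rewrite in_itv/= !ltW.
Qed.

Lemma test_fun_integrable q psi dpsi G : leb.-integrable setT (EFin \o G) ->
  test_fun q psi dpsi -> leb.-integrable setT (EFin \o (fun x => G x * dpsi x)).
Proof.
move=> iG tf; have [M hM] := test_fun_bounded tf; have [_ cd _ _] := tf.
have := @integrableMl _ _ _ leb setT measurableT (EFin \o G) dpsi iG.
apply.
  by exact: continuous_measurable_fun.
exists M; split=> [|y My x _ /=]; first exact: num_real.
exact: le_trans (hM x) (ltW My).
Qed.

Definition dual_values G q : set R :=
  [set \int[leb]_x (G x * p.2 x) | p in [set p | test_fun q p.1 p.2]].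

(** The total variation of [G] on (q, +oo), read off by duality. *)
Definition tail_variation G q : R := sup (dual_values G q).

Lemma measurable_tent (c h : R) (A : set R) : measurable_fun A (tent c h).
Proof.
apply: measurable_funTS; apply: continuous_measurable_fun; exact: continuous_tent.
Qed.

Lemma tent_integral (c h : R) : 0 < h -> (\int[leb]_(x in ball c h) tent c h x = 1)%R.
Proof.
move=> h0; have ch : c - h < c + h by lra.
have cstep : continuous (step c h).
  move=> x; apply/differentiable_continuous/derivable1_diffP.
  by have [] := is_derive_step c h x.
have FTC : (\int[leb]_(x in `[(c - h)%R, (c + h)%R]) (tent c h x)%:E = 1%:E)%E.
  rewrite (@continuous_FTC2 _ (tent c h) (step c h))//.
  - by rewrite -EFinB step_ge// step_le// subr0.
  - by apply: continuous_subspaceT => x; exact: continuous_tent.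
  - split=> [x _||].
    + by have [] := is_derive_step c h x.
    + by apply: cvg_at_right_filter; exact: cstep.
    + by apply: cvg_at_left_filter; exact: cstep.
  - by move=> x _; rewrite derive1E (derive_val (is_derive := is_derive_step c h x)).
rewrite /Rintegral ball_itv integral_itv_bndo_bndc; last first.
  by apply/measurable_EFinP; exact: measurable_tent.
rewrite integral_itv_obnd_cbnd ?FTC//.
by apply/measurable_EFinP; exact: measurable_tent.
Qed.

Lemma tent_bounded (c h : R) (A : set R) : 0 < h -> [bounded tent c h x | x in A].
Proof.
move=> h0; exists h^-1; split=> [|y hy x _ /=]; first exact: num_real.
by have /andP[t0 t1] := @tent_itv _ c h x h0; rewrite ger0_norm// (le_trans t1)// ltW.
Qed.

Lemma integrable_tent G (c h : R) (A : set (measurableTypeR R)) : measurable A ->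
  leb.-integrable A (EFin \o G) -> 0 < h ->
  leb.-integrable A (EFin \o (fun x => G x * tent c h x)).
Proof.
move=> mA iG h0; have mt : measurable_fun A (tent c h) by exact: measurable_tent.
by have := integrableMl mA iG mt (@tent_bounded c h _ h0).
Qed.

(** The hat is at most 1/h on a ball of measure 2h and has integral 1, so its
average of [G] differs from [G c] by at most twice the mean deviation. *)
Lemma tent_average_dist G (c h : R) : leb.-integrable setT (EFin \o G) -> 0 < h ->
  ((`|\int[leb]_x (G x * tent c h x) - G c|)%R%:E <= 2%:E * davg G c h)%E.
Proof.
move=> iG h0; have mB : measurable (ball c h : set (measurableTypeR R)).
  exact: measurable_ball.
have lB : (leb (ball c h) < +oo)%E by rewrite lebesgue_measure_ball ?(ltW h0)// ltry.
have iGB := integrableS measurableT mB (@subsetT _ _) iG.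
have mtB : measurable_fun (ball c h : set (measurableTypeR R)) (tent c h).
  by exact: measurable_tent.
have icB k : leb.-integrable (ball c h) (EFin \o cst k).
  by apply: measurable_bounded_integrable => //; exact: bounded_cst.
have iM g : leb.-integrable (ball c h) (EFin \o g) ->
    leb.-integrable (ball c h) (EFin \o (fun x => g x * tent c h x)).
  by move=> ig; have := integrableMl mB ig mtB (@tent_bounded c h _ h0).
have iD : leb.-integrable (ball c h) (EFin \o (fun x => G x - G c)).
  by have := integrableB mB iGB (icB (G c)).
have -> : \int[leb]_x (G x * tent c h x) = \int[leb]_(x in ball c h) (G x * tent c h x).
  rewrite [RHS]Rintegral_mkcond; apply: eq_Rintegral => x _; rewrite patchE.
  case: ifPn => //; rewrite notin_setE ball_itv /= in_itv/= => /negP.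
  by rewrite negb_and -!leNgt => xB; rewrite tent_out// mulr0.
have GcE : G c = \int[leb]_(x in ball c h) (G c * tent c h x).
  rewrite RintegralZl//; first by rewrite tent_integral// mulr1.
  by apply: eq_integrable (iM _ (icB 1)) => // x _ /=; rewrite mul1r.
rewrite [X in (_ - X)%R]GcE.
rewrite -RintegralB//; [|exact: iM|exact: (iM _ (icB (G c)))].
have -> : \int[leb]_(x in ball c h) (G x * tent c h x - G c * tent c h x) =
    \int[leb]_(x in ball c h) ((G x - G c) * tent c h x).
  by apply: eq_Rintegral => x _; rewrite mulrBl.
rewrite /davg /iavg lebesgue_measure_ball ?(ltW h0)//.
apply: (@le_trans _ _ ((h^-1)%:E * \int[leb]_(y in ball c h) `|(G y - G c)%:E|)%E).
  rewrite -integralZl//; last by apply: integrable_abse.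
  apply: (@le_trans _ _ (\int[leb]_(x in ball c h) `|((G x - G c) * tent c h x)%:E|)%E).
    rewrite /Rintegral -abse_EFin fineK; last exact/integrable_fin_num/iM.
    by apply: le_abse_integral => //; have /integrableP[] := iM _ iD.
  apply: ge0_le_integral => //.
  - by have /integrableP[] := integrable_abse (iM _ iD).
  - by apply: measurable_funeM; have /integrableP[] := integrable_abse iD.
  move=> x _ /=; rewrite normrM -EFinM lee_fin mulrC; apply: ler_wpM2r => //.
  by have /andP[t0 t1] := @tent_itv _ c h x h0; rewrite ger0_norm.
rewrite muleA inver; case: eqP => [/eqP|_]; first by rewrite mulrn_eq0/= gt_eqF.
rewrite -EFinM -[h *+ 2]mulr_natl invfM mulrA divff// mul1r.
by [].
Qed.

Lemma tent_average_cvg G (c : R) : leb.-integrable setT (EFin \o G) ->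
  lebesgue_pt G c ->
  \int[leb]_x (G x * tent c h x) @[h --> (0:R)^'+] --> G c.
Proof.
move=> iG Gc; apply/cvgrPdist_le => e e0.
have e20 : (0 < (e / 2)%:E)%E by rewrite lte_fin divr_gt0.
have := Gc; move=> /fine_cvgP[Gfin /cvgrPdist_le /(_ _ (divr_gt0 e0 (ltr0Sn _ 1)))].
move=> Gd.
near=> h; have h0 : 0 < h by near: h; exact: nbhs_right_gt.
rewrite distrC -lee_fin; apply: (le_trans (tent_average_dist c iG h0)).
have hfin : davg G c h \is a fin_num by near: h.
rewrite -(fineK hfin) -EFinM lee_fin -ler_pdivlMl// mulrC.
have : `|0 - fine (davg G c h)| <= e / 2 by near: h.
by rewrite sub0r normrN ger0_norm// fine_ge0// davg_ge0.
Unshelve. all: by end_near. Qed.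

End test_functions.

(** * Diagonal extraction *)

Section diagonal.
Context {R : realType}.

(** A sequence that is eventually within any given distance of a convergent
one is Cauchy. *)
Lemma cvgn_near_approx (u : R^nat) :
  (forall e, 0 < e -> exists v : R^nat, cvgn v /\
    \forall n \near \oo, `|u n - v n| <= e) ->
  cvgn u.
Proof.
move=> H; apply/cauchy_cvgP/cauchy_exP => e e0.
have e40 : 0 < e / 4 by rewrite divr_gt0.
have [v [/cvg_ex[l vl] uv]] := H _ e40.
exists l; suff : \forall n \near \oo, ball l e (u n) by [].
near=> n.
rewrite /ball /= distrC (_ : u n - l = (u n - v n) + (v n - l)); last by ring.
rewrite (le_lt_trans (ler_normD _ _))//.
have h1 : `|u n - v n| <= e / 4 by near: n.
have h2 : `|v n - l| <= e / 4.
  by rewrite distrC; near: n; move/cvgrPdist_le : vl; apply.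
by rewrite (le_lt_trans (lerD h1 h2))//; lra.
Unshelve. all: by end_near. Qed.

Lemma increasing_seq_ge_id (g : nat -> nat) : increasing_seq g -> forall n, (n <= g n)%N.
Proof.
move=> ig; elim=> [//|n ih]; apply: (leq_ltn_trans ih).
by rewrite ltnNge; have := ig n.+1 n; rewrite leEnat => ->; rewrite -ltnNge.
Qed.

(** Cantor's diagonal argument on top of Bolzano-Weierstrass. *)
Lemma diagonal_subsequence (f : nat -> R^nat) (B : nat -> R) :
  (forall j n, `|f j n| <= B j) ->
  exists k : nat -> nat, {homo k : m n / (m < n)%N} /\ forall j, cvgn (f j \o k).
Proof.
move=> fB.
have bd j (s : nat -> nat) : bounded_fun (f j \o s).
  exists (B j); split=> [|y By n _ /=]; first exact: num_real.
  exact: le_trans (fB _ _) (ltW By).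
have : forall u : R^nat, exists g : nat -> nat,
    increasing_seq g /\ (bounded_fun u -> cvgn (u \o g)).
  move=> u; have [/bolzano_weierstrass[g ig ug]|nb] := pselect (bounded_fun u).
    by exists g.
  by exists id; split.
move=> /choice[S hS].
pose sg := fix sg j := if j is j'.+1 then sg j' \o S (f j \o sg j') else S (f 0).
have isg j : increasing_seq (sg j).
  elim: j => [|j ih]; first by have [] := hS (f 0).
  by move=> m n /=; rewrite ih; have [+ _] := hS (f j.+1 \o sg j); apply.
have csg j : cvgn (f j \o sg j).
  case: j => [|j]; first by have [_] := hS (f 0); apply; exact: bd _ id.
  by have [_] := hS (f j.+1 \o sg j); apply; exact: bd.
(* the n-th extraction refines the j-th one, so the diagonal is, from rank j on,
   a subsequence of the j-th extraction *)
have tail j n : (j <= n)%N -> exists2 t, increasing_seq t & sg n = sg j \o t.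
  move=> /subnK <-; elim: (n - j)%N => [|m [t it e]]; first by exists id.
  have [iS _] := hS (f (m + j).+1 \o sg (m + j)%N).
  exists (t \o S (f (m + j).+1 \o sg (m + j)%N)).
    by move=> a b /=; rewrite it; exact: iS.
  by rewrite /= e.
exists (fun n => sg n n); split.
  apply: homo_ltn => [x y z xy|n]; first exact: ltn_trans.
  have [iS _] := hS (f n.+1 \o sg n); rewrite /= ltnNge.
  have := isg n (S (f n.+1 \o sg n) n.+1) n; rewrite !leEnat => ->.
  by rewrite -ltnNge; exact: increasing_seq_ge_id.
move=> j; have /cvg_ex[l hl] := csg j.
apply/cvg_ex; exists l; apply/cvgrPdist_le => e e0.
move/cvgrPdist_le : hl => /(_ e e0)[N _ hN].
exists (maxn N j) => // n /=; rewrite geq_max => /andP[Nn jn].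
have [t it st] := tail j n jn.
rewrite /= st /=; apply: hN => /=; exact: leq_trans Nn (increasing_seq_ge_id it n).
Qed.

End diagonal.

(** * Variation by duality and pointwise values *)

Section tail_variation.
Context {R : realType}.
Implicit Types (q s t : R) (G psi dpsi : R -> R).
Local Notation leb := (@lebesgue_measure R).

Lemma test_fun0 q : test_fun q (cst 0) (cst 0).
Proof.
split; first by move=> x; exact: is_derive_cst.
- by move=> x; exact: cvg_cst.
- by move=> x /=; rewrite normr0.
- by exists (q + 1), (q + 2); split; first by rewrite ltrDl.
Qed.

Lemma dual_values0 G q : dual_values G q 0.
Proof.
exists (cst 0, cst 0); first exact: test_fun0.
rewrite /=; under eq_Rintegral do rewrite mulr0.
by rewrite Rintegral_cst// mul0r.
Qed.

Lemma dual_values_mono G q q' : q <= q' -> dual_values G q' `<=` dual_values G q.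
Proof.
move=> qq' _ [p [h1 h2 h3 [c [d [qc h4]]]] <-]; exists p => //; split => //.
by exists c, d; split => //; exact: le_lt_trans qc.
Qed.

Lemma tail_variation_ub G q K : ubound (dual_values G q) K -> tail_variation G q <= K.
Proof. by move=> ubK; apply: ge_sup => //; exists 0; exact: dual_values0. Qed.

Lemma tail_variation_ge0 G q K : ubound (dual_values G q) K -> 0 <= tail_variation G q.
Proof. by move=> ubK; apply: ub_le_sup; [exists K|exact: dual_values0]. Qed.

Lemma test_fun_step_diff s t h : s < t -> 0 < h -> h <= (t - s) / 2 ->
  forall x, `|step s h x - step t h x| <= 1.
Proof.
move=> st h0 hst x; have /andP[s0 s1] := @step_itv _ s h x h0.
have /andP[t0 t1] := @step_itv _ t h x h0.
by rewrite ler_norml; lra.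
Qed.

(** [step s h - step t h] takes values in [0, 1] and vanishes beyond [c], where
[psi] starts, so the two bounds by 1 never add up. *)
Lemma test_fun_bump q s t h c d psi dpsi (a : R) :
  q < s - h -> s < t -> 0 < h -> h <= (t - s) / 2 -> t + h <= c -> `|a| <= 1 ->
  test_fun q psi dpsi ->
  (forall x, (x <= c) || (d <= x) -> psi x = 0 /\ dpsi x = 0) ->
  test_fun q (fun x => psi x + a * (step s h x - step t h x))
             (fun x => dpsi x + a * (tent s h x - tent t h x)).
Proof.
move=> qs st h0 hst tc a1 [dp cp p1 _] out; split.
- move=> x; have ? := dp x; have ? := is_derive_step s h x.
  have ? := is_derive_step t h x.
  exact: (@is_deriveD _ _ _ psi (a \*: (step s h - step t h))).
- move=> x; apply: cvgD; first exact: cp.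
  apply: cvgM; first exact: cvg_cst.
  by apply: cvgB; exact: continuous_tent.
- move=> x; have [xc|cx] := leP x c.
    rewrite (out _ _).1 ?xc// add0r normrM mulr_ile1//.
    exact: test_fun_step_diff.
  by rewrite !step_ge ?subrr ?mulr0 ?addr0//; lra.
- exists (s - h), (Num.max d c); split => // x /orP[xs|].
    rewrite (out _ _).1 ?(out _ _).2; [|apply/orP; left; lra..].
    rewrite !step_le ?tent_out ?subrr ?mulr0 ?addr0//; lra.
  rewrite ge_max => /andP[dx cx].
  rewrite (out _ _).1 ?(out _ _).2 ?dx ?orbT//.
  rewrite !step_ge ?tent_out ?subrr ?mulr0 ?addr0//; first [lra|apply/orP; right; lra].
Qed.

(** Let the width h of the steps tend to 0: the averages of [G] against the two
hats tend to [G s] and [G t]. *)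
(** The variation on (q, +oo) splits into what happens between s and t, which is
at least [|G s - G t|], and the variation on (t, +oo). *)
Lemma tail_variation_drop_test G q s t K y (a : R) :
  leb.-integrable setT (EFin \o G) -> ubound (dual_values G q) K ->
  q < s -> s < t -> lebesgue_pt G s -> lebesgue_pt G t -> `|a| <= 1 ->
  dual_values G t y -> y + a * (G s - G t) <= tail_variation G q.
Proof.
move=> iG ubK qs st Gs Gt a1 [[psi dpsi] /= tf <-].
have tfq : test_fun q psi dpsi.
  have [h1 h2 h3 [c [d [tc h4]]]] := tf; split => //.
  by exists c, d; split => //; lra.
have [_ _ _ [c [d [tc out]]]] := tf.
have lim : \int[leb]_x (G x * dpsi x) +
    a * (\int[leb]_x (G x * tent s h x) - \int[leb]_x (G x * tent t h x))
    @[h --> (0:R)^'+] --> \int[leb]_x (G x * dpsi x) + a * (G s - G t).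
  apply: cvgD; first exact: cvg_cst.
  apply: cvgM; first exact: cvg_cst.
  by apply: cvgB; exact: tent_average_cvg.
apply: (@ler_cvg_to _ _ _ _ _ (fun=> tail_variation G q) _ _ lim (cvg_cst _)).
near=> h; have h0 : 0 < h by near: h; exact: nbhs_right_gt.
have hb : h <= Num.min (Num.min ((t - s) / 2) (c - t)) ((s - q) / 2).
  by near: h; apply: nbhs_right_le; rewrite !lt_min; lra.
move: hb; rewrite !le_min => /andP[/andP[hst hct] hsq].
have qsh : q < s - h by lra.
have tch : t + h <= c by lra.
have tfb := test_fun_bump qsh st h0 hst tch a1 tfq out.
have it u : leb.-integrable setT (EFin \o (fun x => G x * tent u h x)).
  exact: integrable_tent.
apply: ub_le_sup; first by exists K.
exists (fun x => psi x + a * (step s h x - step t h x),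
        fun x => dpsi x + a * (tent s h x - tent t h x)) => //=.
under eq_Rintegral do rewrite mulrDr mulrCA mulrBr.
have iB : leb.-integrable setT (EFin \o (fun x => G x * tent s h x - G x * tent t h x)).
  by have := integrableB measurableT (it s) (it t).
rewrite RintegralD ?RintegralZl ?RintegralB//.
- exact: test_fun_integrable tfq.
- by have := integrableZl measurableT a iB.
Unshelve. all: by end_near. Qed.

(** The variation on (q, +oo) splits into what happens between s and t, which is
at least [|G s - G t|], and the variation on (t, +oo). *)
Lemma tail_variation_drop G q s t K :
  leb.-integrable setT (EFin \o G) -> ubound (dual_values G q) K ->
  q < s -> s < t -> lebesgue_pt G s -> lebesgue_pt G t ->
  `|G s - G t| + tail_variation G t <= tail_variation G q.
Proof.
move=> iG ubK qs st Gs Gt.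
rewrite addrC -lerBrDr; apply: tail_variation_ub => y ty; rewrite lerBrDr.
rewrite [`|_|]normrEsg; apply: tail_variation_drop_test ubK _ _ _ _ _ _ => //.
by rewrite normr_sg; case: eqP.
Qed.

(** Otherwise |G| would exceed e almost everywhere on a half-line of infinite
measure. *)
Lemma exists_small_pt G (s e : R) (P : R -> Prop) : leb.-integrable setT (EFin \o G) ->
  {ae leb, forall x, P x} -> 0 < e -> exists t, [/\ s < t, P t & `|G t| <= e].
Proof.
move=> iG aeP e0; apply/not_existsP => H.
have mI : measurable (`]s, +oo[%classic : set (measurableTypeR R)).
  exact: measurable_itv.
have /integrableP[mG Gfin] := integrableS measurableT mI (@subsetT _ _) iG.
suff : (e%:E * leb `]s, +oo[ <= \int[leb]_(x in `]s, +oo[) `|(EFin \o G) x|)%E.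
  rewrite lebesgue_measure_itv /= ltry gt0_muley ?lte_fin//.
  by rewrite leye_eq => /eqP E; rewrite E in Gfin.
rewrite -integral_cst//; apply: ae_ge0_le_integral => //.
- by move=> x _; rewrite lee_fin ltW.
- by apply: measurableT_comp.
apply: filterS aeP; first exact: (ae_filter_ringOfSetsType leb).
move=> x Px; rewrite /= in_itv/= andbT => sx.
rewrite lee_fin leNgt; apply/negP => Ge; apply: (H x); split => //; exact: ltW.
Qed.

(** Compare [G s] with values of [G] at far away Lebesgue points, which can be
taken arbitrarily small. *)
Lemma abs_le_tail_variation G q s K :
  leb.-integrable setT (EFin \o G) -> ubound (dual_values G q) K ->
  {ae leb, forall x, lebesgue_pt G x} ->
  q < s -> lebesgue_pt G s -> `|G s| <= tail_variation G q.
Proof.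
move=> iG ubK aeG qs Gs; apply/ler_addgt0Pr => e e0.
have [t [st Gt Gte]] := @exists_small_pt G s e _ iG aeG e0.
have := tail_variation_drop iG ubK qs st Gs Gt.
have : 0 <= tail_variation G t.
  by apply: (@tail_variation_ge0 _ _ K) => y /dual_values_mono/ubK; apply; lra.
have := ler_normD (G s - G t) (G t); rewrite subrK; lra.
Qed.

End tail_variation.

(** * Helly's selection principle *)

Section helly.
Context {R : realType}.
Local Notation leb := (@lebesgue_measure R).

Lemma ae_dense (P : R -> Prop) (a b : R) : {ae leb, forall x, P x} -> a < b ->
  exists x, P x /\ a < x < b.
Proof.
move=> [N [mN N0 PN]] ab; apply/not_existsP => H.
have : (leb `]a, b[ <= leb N)%E.
  apply: le_measure; rewrite ?inE//.
  move=> x; rewrite /= in_itv/= => axb; apply: PN => /= Px; exact: (H x).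
by rewrite N0 lebesgue_measure_itv /= lte_fin ab -EFinD lee_fin; lra.
Qed.

(** A set of full measure meets every interval with rational end points. *)
Lemma ae_dense_seq (P : R -> Prop) : {ae leb, forall x, P x} ->
  exists p : nat -> R, (forall j, 0 < p j /\ P (p j)) /\
    forall a b, 0 <= a -> a < b -> exists j, a < p j < b.
Proof.
move=> aeP.
have : forall j : nat, exists x : R, (0 < x /\ P x) /\
    forall u v : rat, @unpickle (rat * rat)%type j = Some (u, v) ->
    0 <= u -> u < v -> ratr u < x < ratr v.
  move=> j; have [[[u v] [juv [u0 uv]]]|nuv] :=
    pselect (exists uv : rat * rat, unpickle j = Some uv /\ (0 <= uv.1 /\ uv.1 < uv.2)).
    have [x [Px /andP[ux xv]]] :=
      @ae_dense P (ratr u) (ratr v) aeP ltac:(by rewrite ltr_rat).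
    exists x; split; first by split => //; rewrite (le_lt_trans _ ux)// ler0q.
    by move=> u' v'; rewrite juv => -[<- <-] _ _; rewrite ux.
  have [x [Px /andP[x0 x1]]] := @ae_dense P 0 1 aeP ltr01.
  exists x; split => // u v juv u0 uv; exfalso; apply: nuv.
  by exists (u, v).
move=> /choice[p hp]; exists p; split=> [j|a b a0 ab]; first by have [] := hp j.
have [u /[!in_itv]/= /andP[au ub]] := rat_in_itvoo ab.
have [v /[!in_itv]/= /andP[uv vb]] := rat_in_itvoo ub.
rewrite ltr_rat in uv.
exists (pickle (u, v)); have [_ /(_ u v)] := hp (pickle (u, v)).
rewrite pickleK => /(_ erefl); rewrite -(ler0q R) (le_trans a0 (ltW au)) => /(_ isT uv).
by move=> /andP[ux xv]; rewrite (lt_trans au ux) (lt_trans xv vb).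
Qed.

(** At each such t a rational fits between the values of [L] on the right and those
on the left, and two such rationals are separated by the value of [L] at any
point of the sequence in between.  For [L] a limit of tail variations these are
the jumps of a monotone function. *)
Lemma countable_gaps (p L : nat -> R) :
  (forall a b : R, 0 <= a -> a < b -> exists j, a < p j < b) ->
  countable [set t : R | 0 < t /\ exists2 e, 0 < e &
    forall i j, p i < t -> t < p j -> e <= L i - L j].
Proof.
move=> dense; set B := [set t | _].
have : forall t : R, exists r : rat, B t ->
    forall i j, p i < t -> t < p j -> L j < ratr r < L i.
  move=> t; have [[t0 [e e0 gap]]|nB] := pselect (B t); last by exists 0%R.
  have [i0 /andP[_ i0t]] := dense 0 t (lexx _) t0.
  have [j0 /andP[tj0 _]] := dense t (t + 1) (ltW t0) ltac:(by rewrite ltrDl).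
  pose S := [set L j | j in [set j | t < p j]].
  have hS : has_sup S.
    split; first by exists (L j0), j0.
    by exists (L i0) => _ [j tj <-]; have := gap i0 j i0t tj; lra.
  have [r /[!in_itv]/= /andP[Sr rS]] :=
    @rat_in_itvoo _ (sup S) (sup S + e) ltac:(by rewrite ltrDl).
  exists r => _ i j it tj; apply/andP; split.
    by apply: le_lt_trans Sr; apply: ub_le_sup; [exact: hS.2|exists j].
  apply: (lt_le_trans rS); rewrite -lerBrDr; apply: ge_sup; first exact: hS.1.
  by move=> _ [j' tj' <-]; have := gap i j' it tj'; lra.
move=> /choice[r hr]; apply/countable_injP; exists (pickle \o r).
move=> s t /[!inE] Bs Bt /(pcan_inj pickleK) rst.
wlog st : s t Bs Bt rst / s < t.
  move=> W; have [st|ts|//] := ltgtP s t; first exact: W.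
  by apply/esym/W.
have [s0 _] := Bs; have [t0 _] := Bt.
have [m /andP[sm mt]] := dense s t (ltW s0) st.
have [i /andP[_ si]] := dense 0 s (lexx _) s0.
have [j /andP[tj _]] := dense t (t + 1) (ltW t0) ltac:(by rewrite ltrDl).
have /andP[h1 _] := hr s Bs i m si sm; have /andP[_ h2] := hr t Bt m j mt tj.
by move: (lt_trans h2 h1); rewrite rst ltxx.
Qed.

(** Extract a subsequence along which both the functions and their tail
variations converge on a dense sequence of common Lebesgue points.  Away from
the countably many jumps of the limit variation, the oscillation of [G (k n)]
near t is eventually small, so convergence at nearby points passes to t. *)
Lemma helly (G : nat -> R -> R) (K : R -> R) :
  (forall n, leb.-integrable setT (EFin \o G n)) ->
  (forall n q, 0 < q -> ubound (dual_values (G n) q) (K q)) ->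
  exists k : nat -> nat, {homo k : m n / (m < n)%N} /\
    {ae leb, forall t, 0 < t -> cvgn (fun n => G (k n) t)}.
Proof.
move=> iG ubK.
have locG n : locally_integrable setT (G n).
  by apply: open_integrable_locally; [exact: openT|exact: iG].
have aeG n := lebesgue_differentiation (locG n).
have {}aeP : {ae leb, forall x, forall n, lebesgue_pt (G n) x}.
  exact/ae_foralln.
have [p [hp dense]] := ae_dense_seq aeP.
pose T n q := tail_variation (G n) q.
(* even indices carry the variations, odd ones the values *)
pose f i n := if odd i then G n (p i./2) else T n (p i./2).
pose B i := Num.max (K (p i./2 / 2)) (K (p i./2)).
have fB i n : `|f i n| <= B i.
  have [p0 Gp] := hp i./2; rewrite /f /B le_max; case: ifPn => _; apply/orP.
    left; have p20 : 0 < p i./2 / 2 by rewrite divr_gt0.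
    apply: le_trans (tail_variation_ub (ubK n _ p20)).
    apply: (abs_le_tail_variation (iG n) (ubK n _ p20) (aeG n)) (Gp n); lra.
  right; rewrite ger0_norm; first exact: tail_variation_ub (ubK n _ p0).
  exact: tail_variation_ge0 (ubK n _ p0).
have [k [kinc kcvg]] := diagonal_subsequence fB.
exists k; split => //.
have cT j : cvgn (fun n => T (k n) (p j)).
  by have := kcvg j.*2; rewrite /f /comp odd_double doubleK.
have cG j : cvgn (fun n => G (k n) (p j)).
  by have := kcvg j.*2.+1; rewrite /f /comp /= odd_double /= uphalf_double.
pose L j := limn (fun n => T (k n) (p j)).
have ctb := countable_gaps L dense.
have aeB : {ae leb, forall x, ~ (0 < x /\ exists2 e, 0 < e &
    forall i j, p i < x -> x < p j -> e <= L i - L j)}.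
  exists [set t : R | 0 < t /\ exists2 e, 0 < e &
    forall i j, p i < t -> t < p j -> e <= L i - L j]; split.
  - exact: countable_measurable.
  - exact: countable_lebesgue_measure0.
  - by move=> x /= /contrapT.
apply: filterS2 aeP aeB; first exact: (ae_filter_ringOfSetsType leb).
move=> t Gt nB t0; apply: cvgn_near_approx => e e0.
have [i [j [it [tj Lij]]]] : exists i j, p i < t /\ (t < p j /\ L i - L j < e).
  apply/not_existsP => H; apply: nB; split => //; exists e => // i j it tj.
  rewrite leNgt; apply/negP => Lij; apply: (H i); by exists j.
have [p0 _] := hp i.
have [m /andP[im mt]] := dense (p i) t (ltW p0) it.
exists (fun n => G (k n) (p m)); split => //.
have cij : (fun n => T (k n) (p i) - T (k n) (p j)) @ \oo --> L i - L j.
  by apply: cvgB; exact: cT.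
near=> n.
have ub := ubK (k n) _ p0.
have d1 := tail_variation_drop (iG (k n)) ub im mt ((hp m).2 (k n)) (Gt (k n)).
have t0' : 0 < p m by lra.
have d2 : T (k n) (p j) <= T (k n) t.
  apply: tail_variation_ub => y /(dual_values_mono (ltW tj)) hy.
  apply: ub_le_sup hy; exists (K t); exact: ubK.
rewrite distrC; apply: (@le_trans _ _ (T (k n) (p i) - T (k n) (p j))).
  by rewrite /T in d2 *; lra.
near: n; exact: cvgr_le cij _ Lij.
Unshelve. all: by end_near. Qed.

End helly.

(** * Dilations of Lebesgue measure *)

Section dilation.
Context {R : realType}.
Local Notation leb := (@lebesgue_measure R).
Local Open Scope ereal_scope.

Lemma lebesgue_measure_dilation (c : R) (A : set (measurableTypeR R)) :
  (0 < c)%R -> measurable A ->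
  leb ((fun x => c * x)%R @^-1` A) = c^-1%:E * leb A.
Proof.
move=> c0 mA; pose f : measurableTypeR R -> measurableTypeR R := fun x => (c * x)%R.
have mf : measurable_fun setT f by exact: mulrl_measurable.
pose m := mscale (NngNum (ltW c0)) (pushforward leb f).
have /(_ A mA) -> : forall A, measurable A -> leb A = m mf A.
  apply: lebesgue_measure_unique => _ [[a b] _ <-].
  rewrite /m /= /mscale /= /pushforward.
  have -> : f @^-1` `]a, b] = `](a / c)%R, (b / c)%R]%classic.
    by apply/seteqP; split => x;
      rewrite /f /= !in_itv/= ltr_pdivrMr// ler_pdivlMr// (mulrC x).
  rewrite !lebesgue_measure_itv/= !lte_fin ltr_pM2r ?invr_gt0//.
  case: ifPn => ab; last by rewrite mule0.
  by rewrite -!EFinD -EFinM -mulrBl mulrC divfK// gt_eqF.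
by rewrite /m /= /mscale /= muleA -EFinM mulVf ?gt_eqF// mul1e.
Qed.

Lemma ge0_integral_dilation (c : R) (f : R -> \bar R) : (0 < c)%R ->
  measurable_fun setT f -> (forall x, 0 <= f x) ->
  \int[leb]_x f (c * x)%R = c^-1%:E * \int[leb]_x f x.
Proof.
move=> c0 mf f0; pose g : measurableTypeR R -> measurableTypeR R := fun x => (c * x)%R.
have mg : measurable_fun setT g by exact: mulrl_measurable.
have := @ge0_integral_pushforward _ _ _ _ R g mg leb setT f measurableT mf (fun x _ => f0 x).
rewrite preimage_setT => <-.
have ci0 : (0 <= c^-1)%R by rewrite invr_ge0 ltW.
rewrite (eq_measure_integral (mscale (NngNum ci0) leb)); last first.
  by move=> A mA _; exact: lebesgue_measure_dilation.
by rewrite ge0_integral_mscale.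
Qed.

Lemma lebesgue_rV_dilation n (c : R) (A : set 'rV[R]_n) :
  (0 < c)%R -> measurable A ->
  lebesgue_rV ((fun x => c *: x) @^-1` A) = (c^-1 ^+ n)%:E * lebesgue_rV A.
Proof.
move=> c0; elim: n => [|n ih] in A *.
  move=> mA; rewrite expr0 mul1e /= !diracE.
  congr (_%:E); congr (_%:R); congr nat_of_bool.
  by apply/idP/idP; rewrite !inE /= scaler0.
move=> mA; rewrite /= /lebesgue_rV_cons /pushforward /product_measure1.
set B := cons_rV @^-1` A.
have mB : measurable B.
  by rewrite -[B]setTI; exact: (measurable_cons_rV measurableT mA).
have -> : (fun x => lebesgue_rV (xsection (cons_rV @^-1` ((fun y => c *: y) @^-1` A)) x)) =
    (fun x => (c^-1 ^+ n)%:E * lebesgue_rV (xsection B (c * x)%R)).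
  apply/funext => x; rewrite -ih; last exact: measurable_xsection.
  congr (lebesgue_rV _); apply/seteqP.
  have E y : c *: cons_rV (x, y) = cons_rV ((c * x)%R, c *: y).
    apply/rowP => i; rewrite mxE; case: (unliftP ord0 i) => [j ->|->].
      by rewrite !cons_rVS mxE.
    by rewrite !cons_rV0.
  by split => y; rewrite /xsection /= !inE /= E /= /B.
rewrite ge0_integralZl//; last 2 first.
  - have := measurable_fun_xsection (lebesgue_rV : {sigma_finite_measure set 'rV[R]_n -> \bar R}) mB.
    move=> mX; apply: (measurableT_comp mX) => //; exact: mulrl_measurable.
  - by rewrite lee_fin exprn_ge0// invr_ge0 ltW.
rewrite (@ge0_integral_dilation c (fun x => lebesgue_rV (xsection B x)))//; last first.
  exact: measurable_fun_xsection.
by rewrite muleA -EFinM exprSr.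
Qed.

End dilation.

(** * The law of the volume coordinate *)

Section radial_law.
Context {R : realType} (n : nat) (n_gt0 : (0 < n)%N).
Local Notation leb := (@lebesgue_measure R).
Local Notation mu := (@lebesgue_rV R n).
Implicit Types x y : 'rV[R]_n.

Lemma enorm_ge0 x : 0 <= enorm x. Proof. exact: sqrtr_ge0. Qed.

Lemma sqr_enorm x : enorm x ^+ 2 = \sum_i x ord0 i ^+ 2.
Proof. by rewrite sqr_sqrtr// sumr_ge0// => i _; exact: sqr_ge0. Qed.

Lemma enormZ (c : R) x : enorm (c *: x) = `|c| * enorm x.
Proof.
rewrite /enorm; under eq_bigr do rewrite mxE exprMn.
by rewrite -mulr_sumr sqrtrM ?sqr_ge0// sqrtr_sqr.
Qed.

Lemma coord_le_enorm x i : `|x ord0 i| <= enorm x.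
Proof.
rewrite -(ler_pXn2r (_ : 0 < 2)%N) ?nnegrE ?enorm_ge0// sqr_enorm.
by rewrite real_normK ?num_real// (bigD1 i)//= lerDl sumr_ge0// => j _; exact: sqr_ge0.
Qed.

(** The radial coordinate with respect to which Lebesgue measure becomes uniform. *)
Definition radial_volume x : R := enorm x ^+ n.

Lemma radial_volume_ge0 x : 0 <= radial_volume x.
Proof. by rewrite exprn_ge0// enorm_ge0. Qed.

Lemma radial_volumeZ (c : R) x : 0 <= c ->
  radial_volume (c *: x) = c ^+ n * radial_volume x.
Proof. by move=> c0; rewrite /radial_volume enormZ ger0_norm// exprMn. Qed.

Lemma measurable_coord_rV i : measurable_fun setT (fun x : 'rV[R]_n => x ord0 i).
Proof. have /measurable_fun_rVP mx := @measurable_id _ 'rV[R]_n setT; exact: mx. Qed.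

Lemma measurable_enorm : measurable_fun setT (@enorm R n).
Proof.
apply: measurableT_comp.
  by apply: continuous_measurable_fun; exact: sqrt_continuous.
by apply: measurable_sum => i; apply: measurable_funX; exact: measurable_coord_rV.
Qed.

Lemma measurable_radial_volume :
  measurable_fun setT (radial_volume : 'rV[R]_n -> measurableTypeR R).
Proof. by apply: measurable_funX; exact: measurable_enorm. Qed.

Lemma measurable_radial_preimage (A : set (measurableTypeR R)) :
  measurable A -> measurable (radial_volume @^-1` A).
Proof.
by move=> mA; rewrite -[X in measurable X]setTI; exact: measurable_radial_volume.
Qed.

Lemma lebesgue_rV_cube (a : R) : 0 <= a ->
  mu [set x | forall i, `[- a, a]%classic (x ord0 i)] = ((a *+ 2) ^+ n)%:E.
Proof.
move=> a0; rewrite (@lebesgue_rV_box R n (fun=> `[- a, a]%classic))//.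
under eq_bigr do rewrite lebesgue_measure_itv /=.
rewrite lte_fin.
have -> : (if - a < a then (a%:E - (- a)%:E)%E else 0%E) = (a *+ 2)%:E.
  have [->|an0] := eqVneq a 0; first by rewrite oppr0 ltxx mul0rn.
  have a1 : 0 < a by rewrite lt_neqAle eq_sym an0.
  by rewrite gtrN// -EFinB opprK mulr2n.
by rewrite prodEFin prodr_const card_ord.
Qed.

Definition unit_volume : R := fine (mu [set x | radial_volume x <= 1]).

Lemma measurable_radial_sublevel (b : R) :
  measurable [set x : 'rV[R]_n | radial_volume x <= b].
Proof.
rewrite (_ : mkset _ = radial_volume @^-1` `]-oo, b]%classic); last first.
  by apply/seteqP; split => x; rewrite /= in_itv.
by apply: measurable_radial_preimage; exact: measurable_itv.
Qed.

Let measurable_cube (a : R) :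
  measurable [set x : 'rV[R]_n | forall i, `[- a, a]%classic (x ord0 i)].
Proof.
rewrite (_ : mkset _ = \bigcap_(i in setT) ((fun x : 'rV[R]_n =>
    x ord0 i : measurableTypeR R) @^-1` `[- a, a]%classic)); last first.
  by apply/seteqP; split=> [x Ax i _|x Ax i]; [exact: Ax|exact: (Ax i I)].
apply: fin_bigcap_measurable => // i _.
by rewrite -[X in measurable X]setTI; apply: measurable_coord_rV.
Qed.

Lemma unit_volumeE : mu [set x | radial_volume x <= 1] = unit_volume%:E.
Proof.
rewrite fineK// ge0_fin_numE//.
apply: (@le_lt_trans _ _ (mu [set x | forall i, `[- 1, 1]%classic (x ord0 i)])).
  apply: le_measure; rewrite ?inE.
  - exact: measurable_radial_sublevel.
  - exact: measurable_cube.
  move=> x /=; rewrite /radial_volume expr_le1 ?enorm_ge0// => x1 i.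
  by rewrite /= in_itv/= -ler_norml (le_trans (coord_le_enorm x i)).
by rewrite lebesgue_rV_cube// ltry.
Qed.

Lemma unit_volume_gt0 : 0 < unit_volume.
Proof.
rewrite -lte_fin -unit_volumeE.
have n0 : 0 < n%:R :> R by rewrite ltr0n.
apply: (@lt_le_trans _ _ (mu [set x | forall i, `[- n%:R^-1, n%:R^-1]%classic (x ord0 i)])).
  by rewrite lebesgue_rV_cube ?invr_ge0// lte_fin exprn_gt0// mulrn_wgt0// invr_gt0.
apply: le_measure; rewrite ?inE.
- exact: measurable_cube.
- exact: measurable_radial_sublevel.
move=> x /= xn; rewrite /radial_volume expr_le1 ?enorm_ge0//.
rewrite -(ler_pXn2r (_ : 0 < 2)%N) ?nnegrE ?enorm_ge0// sqr_enorm expr1n.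
apply: (@le_trans _ _ (\sum_(i < n) n%:R^-1 ^+ 2)).
  apply: ler_sum => i _; have := xn i; rewrite /= in_itv/= -ler_norml => xi.
  by rewrite -(real_normK (num_real (x ord0 i))) ler_pXn2r ?nnegrE ?invr_ge0.
rewrite sumr_const card_ord -[X in X <= _]mulr_natl expr2 mulrA divff ?gt_eqF// mul1r.
by rewrite invf_le1// ler1n.
Qed.

(** The ball of volume coordinate b is the unit ball dilated by the n-th root of b. *)
Lemma lebesgue_radial_volume_le0 : mu [set x | radial_volume x <= 0] = 0%E.
Proof.
apply: (@subset_measure0 _ _ _ mu _ [set x | forall i, `[- 0, 0]%classic (x ord0 i)]) => //.
- exact: measurable_radial_sublevel.
- exact: measurable_cube.
- move=> x /=; rewrite /radial_volume => x0 i; rewrite /= in_itv/= -ler_norml.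
  rewrite (le_trans (coord_le_enorm x i))//.
  by rewrite leNgt; apply: contraTN x0 => h; rewrite -ltNge exprn_gt0.
- by have := @lebesgue_rV_cube 0 (lexx _); rewrite mul0rn expr0n gtn_eqF.
Qed.

(** The ball of volume coordinate b is the unit ball dilated by the n-th root of b. *)
Lemma lebesgue_radial_volume_le (b : R) : 0 <= b ->
  mu [set x | radial_volume x <= b] = (unit_volume * b)%:E.
Proof.
rewrite le_eqVlt => /predU1P[<-|b0].
  by rewrite lebesgue_radial_volume_le0 mulr0.
pose c := b `^ (n%:R^-1).
have c0 : 0 < c by exact: powR_gt0.
have cn : c ^+ n = b.
  by rewrite -powR_mulrn ?(ltW c0)// -powRrM mulVf ?powRr1 ?(ltW b0)// pnatr_eq0 gtn_eqF.
have -> : [set x | radial_volume x <= b] =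
    (fun x => c^-1 *: x) @^-1` [set x | radial_volume x <= 1].
  apply/seteqP; split => x /=;
  by rewrite radial_volumeZ ?invr_ge0 ?(ltW c0)// exprVn cn ler_pdivrMl// mulr1.
rewrite lebesgue_rV_dilation ?invr_gt0//; last exact: measurable_radial_sublevel.
rewrite invrK cn unit_volumeE.
by rewrite -EFinM mulrC.
Qed.

(** The balls determine the law of the volume coordinate on (0, +oo).  Completing
it by Lebesgue measure on the negative half-line gives a measure on R to which
uniqueness of Lebesgue measure applies. *)
Lemma radial_law (A : set (measurableTypeR R)) : measurable A ->
  A `<=` `]0, +oo[ -> mu (radial_volume @^-1` A) = (unit_volume%:E * leb A)%E.
Proof.
move=> mA A0; have w0 := unit_volume_gt0.
have wi0 : 0 <= unit_volume^-1 by rewrite invr_ge0 ltW.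
have mpos : measurable (`]0, +oo[%classic : set (measurableTypeR R)) by exact: measurable_itv.
have mneg : measurable (`]-oo, 0]%classic : set (measurableTypeR R)) by exact: measurable_itv.
pose m := measure_add
  (mscale (NngNum wi0)
    (mrestr (pushforward mu (radial_volume : 'rV[R]_n -> measurableTypeR R)) mpos))
  (mrestr leb mneg).
have mE B : m measurable_radial_volume B =
    ((unit_volume^-1)%:E * mu (radial_volume @^-1` (B `&` `]0%R, +oo[))
                  + leb (B `&` `]-oo, 0%R]))%E.
  by rewrite /m measure_addE.
have /(_ A mA) : forall A, measurable A -> leb A = m measurable_radial_volume A.
  apply: lebesgue_measure_unique => _ [[a b] _ <-]; apply: etrans (esym (mE _)) => /=.
  have [ba|ab] := leP b a.
    rewrite set_itv_ge ?bnd_simp ?leNgt; last by rewrite -leNgt.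
    by rewrite !set0I preimage_set0 !measure0 mule0 add0e.
  have -> : `]a, b] `&` `]0, +oo[ = `]Num.max a 0, b]%classic.
    apply/seteqP; split => x /=; rewrite !in_itv/= andbT gt_max.
      by move=> [/andP[-> ->] ->].
    by move=> /andP[/andP[-> ->] ->].
  have -> : `]a, b] `&` `]-oo, 0] = `]a, Num.min b 0]%classic.
    apply/seteqP; split => x /=; rewrite !in_itv/= le_min.
      by move=> [/andP[-> ->] ->].
    by move=> /andP[-> /andP[-> ->]].
  have -> : radial_volume @^-1` `]Num.max a 0, b] =
     [set x : 'rV[R]_n | radial_volume x <= b] `\` [set x | radial_volume x <= Num.max a 0].
    apply/seteqP; split => x /=; rewrite !in_itv/=.
      by move=> /andP[h1 h2]; split => //; apply/negP; rewrite -ltNge.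
    by move=> [h1 /negP]; rewrite -ltNge => ->.
  have [b0|b0] := leP b 0.
    rewrite (_ : _ `\` _ = set0) ?measure0 ?mule0 ?add0e//.
    apply/seteqP; split => // x /= [h1]; apply.
    by rewrite (le_trans h1)// le_max b0 orbT.
  have finb : (mu [set x | (radial_volume x <= b)%R] < +oo)%E.
    by rewrite lebesgue_radial_volume_le ?(ltW b0)// ltry.
  have max0 : 0 <= Num.max a 0 by rewrite le_max lexx orbT.
  have -> : mu ([set x | (radial_volume x <= b)%R] `\`
      [set x | (radial_volume x <= Num.max a 0)%R]) =
      ((unit_volume * b)%:E - (unit_volume * Num.max a 0)%:E)%E.
    apply: etrans (measureD _ _ finb) _; [exact: measurable_radial_sublevel..|].
    rewrite setIidr; last by move=> x /= /le_trans; apply; rewrite ge_max !ltW.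
    congr (_ - _)%E; apply: lebesgue_radial_volume_le => //; exact: ltW.
  rewrite -EFinD -mulrBr -EFinM mulKf ?gt_eqF//.
  rewrite !lebesgue_measure_itv/= !lte_fin ab.
  by case: (ltP a 0) => a0; rewrite -?EFinD ?adde0//; congr EFin; ring.
move=> lA; have := mE A; rewrite -[LHS]lA => ->.
rewrite (setIidl A0) (_ : A `&` _ = set0) ?measure0 ?adde0; last first.
  apply/seteqP; split => // x [/A0 + ]; rewrite /= !in_itv/= andbT => h1 h2; lra.
by rewrite muleA -EFinM divff ?gt_eqF// mul1e.
Qed.

End radial_law.

(** * Integrals of radial functions *)

Section radial_integral.
Context {R : realType} (n : nat) (n_gt0 : (0 < n)%N).
Local Notation leb := (@lebesgue_measure R).
Local Notation mu := (@lebesgue_rV R n).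
Local Notation rv := (@radial_volume R n).
Implicit Types x y : 'rV[R]_n.

Lemma measurable_pos : measurable (`]0, +oo[%classic : set (measurableTypeR R)).
Proof. exact: measurable_itv. Qed.

Lemma ae_radial_pos : {ae mu, forall x, 0 < rv x}.
Proof.
exists [set x | rv x <= 0]; split.
- exact: measurable_radial_sublevel.
- exact: lebesgue_radial_volume_le0.
- by move=> x /= /negP; rewrite -leNgt.
Qed.

Lemma ae_radial (P : R -> Prop) : {ae leb, forall t, 0 < t -> P t} ->
  {ae mu, forall x, P (rv x)}.
Proof.
move=> [N [mN N0 NP]].
have : {ae mu, forall x, 0 < rv x -> P (rv x)}.
  exists (rv @^-1` (N `&` `]0, +oo[)); split.
  - by apply: measurable_radial_preimage; apply: measurableI => //; exact: measurable_pos.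
  - rewrite radial_law//.
    + rewrite (_ : leb _ = 0%E) ?mule0//.
      by apply: (subset_measure0 _ mN) => //; apply: measurableI => //; exact: measurable_pos.
    + by apply: measurableI => //; exact: measurable_pos.
  - move=> x /= /not_implyP[x0 nP]; split; last by rewrite /= in_itv/= x0.
    by apply: NP => /=; apply/not_implyP.
apply: filterS2 ae_radial_pos.
by move=> x x0 /(_ x0).
Qed.

Lemma ge0_integral_radial (f : R -> \bar R) :
  measurable_fun setT f -> (forall t, 0 <= f t)%E ->
  (\int[mu]_x f (rv x) = (@unit_volume R n)%:E * \int[leb]_(t in `]0%R, +oo[) f t)%E.
Proof.
move=> mf f0; have w0 := @unit_volume_gt0 R n n_gt0.
have mD : measurable (rv @^-1` `]0, +oo[).
  by apply: measurable_radial_preimage; exact: measurable_pos.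
transitivity (\int[mu]_(x in rv @^-1` `]0%R, +oo[) f (rv x))%E.
  rewrite [RHS]integral_mkcond; apply: ae_eq_integral => //.
  - by apply: (measurableT_comp mf); exact: measurable_radial_volume.
  - apply/(measurable_restrictT _ mD); apply: measurable_funTS.
    by apply: (measurableT_comp mf); exact: measurable_radial_volume.
  - apply: filterS ae_radial_pos.
    by move=> x x0 _; rewrite patchE mem_set//= in_itv/= x0.
have := @ge0_integral_pushforward _ _ _ _ R _ (@measurable_radial_volume R n) mu
  `]0, +oo[%classic f measurable_pos (measurable_funTS mf) (fun t _ => f0 t).
move=> <-.
rewrite (eq_measure_integral (mscale (NngNum (ltW w0)) leb)); last first.
  by move=> A mA A0; exact: radial_law.
- exact: measurable_radial_volume.
- by rewrite ge0_integral_mscale//; exact: measurable_funTS.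
Qed.

Lemma ge0_integral_radialT (f : R -> \bar R) :
  measurable_fun setT f -> (forall t, 0 <= f t)%E -> (forall t, t <= 0 -> f t = 0%E) ->
  (\int[mu]_x f (rv x) = (@unit_volume R n)%:E * \int[leb]_t f t)%E.
Proof.
move=> mf f0 fN; rewrite ge0_integral_radial//; congr (_ * _)%E.
rewrite integral_mkcond; apply: eq_integral => t _; rewrite patchE; case: ifPn => //.
by rewrite notin_setE /= in_itv/= andbT => /negP; rewrite -leNgt => /fN.
Qed.

Lemma Rintegral_radial (f : R -> R) :
  leb.-integrable setT (EFin \o f) -> (forall t, t <= 0 -> f t = 0) ->
  (\int[mu]_x (f (rv x))%:E = (@unit_volume R n * \int[leb]_t f t)%:E)%E.
Proof.
move=> intf fN; have /integrableP[mf _] := intf.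
rewrite integralE.
have -> : (\int[mu]_x ((fun x => (f (rv x))%:E)^\+ x) =
    (@unit_volume R n)%:E * \int[leb]_t ((EFin \o f)^\+ t))%E.
  rewrite -ge0_integral_radialT//.
  - by apply: eq_integral => x _; rewrite !funeposE.
  - exact: measurable_funepos.
  - by move=> t t0; rewrite funeposE /= fN// maxxx.
have -> : (\int[mu]_x ((fun x => (f (rv x))%:E)^\- x) =
    (@unit_volume R n)%:E * \int[leb]_t ((EFin \o f)^\- t))%E.
  rewrite -ge0_integral_radialT//.
  - by apply: eq_integral => x _; rewrite !funenegE.
  - exact: measurable_funeneg.
  - by move=> t t0; rewrite funenegE /= fN// ?oppr0 ?oppe0 maxxx.
have fp := integrable_pos_fin_num measurableT intf.
have fm := integrable_neg_fin_num measurableT intf.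
have [a ha] : exists a, (\int[leb]_t (EFin \o f)^\+ t = a%:E)%E.
  by exists (fine (\int[leb]_t (EFin \o f)^\+ t)); rewrite fineK.
have [b hb] : exists b, (\int[leb]_t (EFin \o f)^\- t = b%:E)%E.
  by exists (fine (\int[leb]_t (EFin \o f)^\- t)); rewrite fineK.
by rewrite /Rintegral integralE ha hb -!EFinM -!EFinB /= mulrBr.
Qed.

End radial_integral.

(** * Measurable radial profiles *)

Section radial_representative.
Context {R : realType} (n : nat) (n_gt0 : (0 < n)%N).
Local Notation leb := (@lebesgue_measure R).
Local Notation mu := (@lebesgue_rV R n).
Local Notation rv := (@radial_volume R n).
Implicit Types x y : 'rV[R]_n.

Definition nth_root (t : R) : R := t `^ (n%:R^-1).

Lemma nth_root_gt0 t : 0 < t -> 0 < nth_root t.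
Proof. exact: powR_gt0. Qed.

Lemma nth_rootK t : 0 < t -> nth_root t ^+ n = t.
Proof.
move=> t0; rewrite -powR_mulrn ?powR_ge0// -powRrM mulVf ?powRr1 ?(ltW t0)//.
by rewrite pnatr_eq0 gtn_eqF.
Qed.

Lemma nth_root_expr r : 0 <= r -> nth_root (r ^+ n) = r.
Proof.
move=> r0; rewrite -powR_mulrn// /nth_root -powRrM mulfV ?powRr1//.
by rewrite pnatr_eq0 gtn_eqF.
Qed.

Lemma measurable_nth_root : measurable_fun setT (nth_root : measurableTypeR R -> R).
Proof. exact: measurable_powR. Qed.

Lemma measurable_root_scale :
  measurable_fun setT (fun p : measurableTypeR R * 'rV[R]_n => nth_root p.1 *: p.2).
Proof.
apply/measurable_fun_rVP => i; under eq_fun do rewrite mxE.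
apply: measurable_funM.
  by apply: (measurableT_comp measurable_nth_root); exact: measurable_fst.
by apply: (measurableT_comp (measurable_coord_rV i)); exact: measurable_snd.
Qed.

(** Dilations preserve null sets, so for every t > 0 almost no x has its dilate in
[E]; exchange the quantifiers by Tonelli's theorem. *)
Lemma ae_ray (E : set 'rV[R]_n) : measurable E -> mu E = 0%E ->
  exists x, 0 < rv x /\ {ae leb, forall t, 0 < t -> ~ E (nth_root t *: x)}.
Proof.
move=> mE E0.
pose A : set (measurableTypeR R * 'rV[R]_n) :=
  [set p | 0 < p.1 /\ E (nth_root p.1 *: p.2)].
have mA : measurable A.
  rewrite (_ : A = (`]0, +oo[ `*` setT) `&`
      (fun p => nth_root p.1 *: p.2) @^-1` E); last first.
    apply/seteqP; split => [[t x] /= [t0 Ex]|[t x] /=].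
      by split => //=; rewrite in_itv/= andbT.
    by move=> [[/= +] _]; rewrite in_itv/= andbT.
  apply: measurableI.
    by apply: measurableX => //; exact: measurable_pos.
  by rewrite -[X in measurable X]setTI; exact: measurable_root_scale.
have := @indic_fubini_tonelli _ _ _ _ R leb mu A mA.
rewrite indic_fubini_tonelli_FE// indic_fubini_tonelli_GE//.
rewrite (_ : \int[leb]_x _ = 0)%E; last first.
  apply: integral0_eq => t _ /=; have [t0|t0] := ltP 0 t; last first.
    rewrite (_ : xsection A t = set0) ?measure0//.
    apply/seteqP; split => // x; rewrite /xsection /= inE /A /= => -[]; lra.
  rewrite (_ : xsection A t = (fun x => nth_root t *: x) @^-1` E).
    by rewrite lebesgue_rV_dilation ?nth_root_gt0// E0 mule0.
  apply/seteqP; split => x; rewrite /xsection /= inE /A /=; first by case.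
  by split.
move=> /esym int0.
have mG : measurable_fun setT (leb \o ysection A).
  exact: measurable_fun_ysection.
have : {ae mu, forall x, leb (ysection A x) = 0%E}.
  have : (\int[mu]_x `|(leb \o ysection A) x| = 0)%E.
    by rewrite -[RHS]int0; apply: eq_integral => x _; rewrite gee0_abs.
  move=> /(ae_eq_integral_abs mu measurableT mG).
  by apply: filterS => x /(_ I).
move=> aeA.
have muT : (0 < mu setT)%E.
  apply: (@lt_le_trans _ _ (mu [set x | (rv x <= 1)%R])) => //.
    by rewrite unit_volumeE//; have := @unit_volume_gt0 R n n_gt0; rewrite -lte_fin.
  by apply: le_measure; rewrite ?inE//; exact: measurable_radial_sublevel.
have [x [Ax x0]] : exists x, leb (ysection A x) = 0%E /\ 0 < rv x.
  have PF := ae_properfilter_algebraOfSetsType muT.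
  have H : {ae mu, forall x, leb (ysection A x) = 0%E /\ 0 < rv x}.
    by apply: filterS2 aeA (ae_radial_pos n_gt0) => x; split.
  exact: (@filter_ex _ _ PF _ H).
exists x; split => //; exists (ysection A x); split => //.
  exact: measurable_ysection.
move=> t /= /not_implyP[t0 /contrapT Et].
by rewrite /ysection /= inE.
Qed.

(** The function [g] need not be measurable.  But a measurable profile is obtained by
restricting [u] to a ray that meets the exceptional null set in a null set of
parameters, and it agrees with [g] for almost every radius. *)
Lemma radial_representative (u : 'rV[R]_n -> R) (g : R -> R) :
  measurable_fun setT u -> {ae mu, forall x, u x = g (enorm x)} ->
  exists G : R -> R, [/\ measurable_fun setT (G : measurableTypeR R -> R),
    forall t, t <= 0 -> G t = 0 & {ae mu, forall x, u x = G (rv x)}].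
Proof.
move=> mu_ [E [mE E0 Eg]].
have [x0 [rx0 [Z [mZ Z0 ZE]]]] := ae_ray mE E0.
(* the point of the ray through x0 whose volume coordinate is t *)
pose G t := if 0 < t then u (nth_root (t / rv x0) *: x0) else 0.
exists G; split.
- rewrite (_ : G = (fun t => u (nth_root ((rv x0)^-1 * t) *: x0)) \_ `]0, +oo[); last first.
    apply/funext => t; rewrite /G patchE mulrC; case: ifPn => t0.
      by rewrite mem_set//= in_itv/= t0.
    by rewrite memNset//= in_itv/= (negbTE t0).
  apply/(measurable_restrictT _ measurable_pos); apply: measurable_funTS.
  apply: (measurableT_comp mu_).
  apply/measurable_fun_rVP => i; under eq_fun do rewrite mxE.
  apply: measurable_funM => //; apply: (measurableT_comp measurable_nth_root).
  exact: mulrl_measurable.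
- by move=> t t0; rewrite /G ltNge t0.
have aeZ : {ae leb, forall t, 0 < t -> ~ Z ((rv x0)^-1 * t)}.
  exists ((fun t => (rv x0)^-1 * t) @^-1` Z); split.
  - by rewrite -[X in measurable X]setTI; apply: mulrl_measurable.
  - by rewrite lebesgue_measure_dilation ?invr_gt0// Z0 mule0.
  - by move=> t /= /not_implyP[_ /contrapT].
have aeE : {ae mu, forall x, ~ E x}.
  by exists E; split => // x /= /contrapT.
apply: filterS3 aeE (ae_radial_pos n_gt0) (ae_radial n_gt0 aeZ).
move=> x Ex x_pos Zx; have ux : u x = g (enorm x) by apply: contrapT => /Eg.
have s0 : 0 < (rv x0)^-1 * rv x by rewrite mulr_gt0// invr_gt0.
rewrite ux /G x_pos (mulrC (rv x)).
have nE : ~ E (nth_root ((rv x0)^-1 * rv x) *: x0).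
  by apply: contra_not Zx => Ex0; apply: ZE => /=; apply/not_implyP;
    split => //; exact/contrapT.
have -> : u (nth_root ((rv x0)^-1 * rv x) *: x0) =
    g (enorm (nth_root ((rv x0)^-1 * rv x) *: x0)) by apply: contrapT => /Eg.
congr g; rewrite enormZ ger0_norm ?(ltW (nth_root_gt0 _))//.
rewrite -[in LHS](@nth_root_expr (enorm x))// ?enorm_ge0//.
rewrite /nth_root powRM ?invr_ge0 ?radial_volume_ge0//.
have e0 : enorm x0 = nth_root (rv x0) by rewrite /radial_volume nth_root_expr ?enorm_ge0.
rewrite e0 /nth_root mulrAC -powRM ?invr_ge0 ?radial_volume_ge0//.
by rewrite mulVf ?gt_eqF// powR1 mul1r.
Qed.

End radial_representative.

(** * Radial test fields *)

Section radial_profile.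
Context {R : realType} (n : nat) (n_gt0 : (0 < n)%N).
Variables (q : R) (psi dpsi : R -> R).
Implicit Types (s r w : R).
Hypotheses (q_gt0 : 0 < q) (tf : test_fun q psi dpsi).

Let W (s : R) : R := Num.sqrt s ^+ n.

Let W_gt0 s : 0 < s -> 0 < W s.
Proof. by move=> s0; rewrite exprn_gt0// sqrtr_gt0. Qed.

Let W_le0 s : s <= 0 -> W s = 0.
Proof. by move=> s0; rewrite /W ler0_sqrtr// expr0n gtn_eqF. Qed.

Let continuous_W : continuous W.
Proof.
move=> s; apply: (@continuous_comp _ _ _ Num.sqrt (fun y => y ^+ n)).
  exact: sqrt_continuous.
exact: exprn_continuous.
Qed.

Let is_derive_W s : 0 < s -> is_derive s (1 : R) W (n%:R / 2 * (W s / s)).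
Proof.
move=> s0; have ds := is_derive1_sqrt s0.
have r0 : 0 < Num.sqrt s by rewrite sqrtr_gt0.
have -> : W s / s = Num.sqrt s ^+ n.-1 / Num.sqrt s.
  rewrite /W -[in LHS](prednK n_gt0) exprS -[X in _ / X](sqr_sqrtr (ltW s0)).
  by field; rewrite gt_eqF.
rewrite (_ : W = Num.sqrt ^+ n); last by apply/funext => y; rewrite exprfctE.
apply: (is_derive_eq (is_deriveX n ds)).
by rewrite /GRing.scale /=; field; rewrite gt_eqF.
Qed.

(** The largest constant for which the test field below is bounded by 1: q^((n-1)/n). *)
(** As a function of s = |x|^2, which is smooth in x: the coefficient K of the
field K x with K = psi(t) / t up to scaling, where t = |x|^n.  The quotient by t
makes the divergence a multiple of psi'(t). *)
Definition profile_scale : R := nth_root n q ^+ n.-1.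

(** As a function of s = |x|^2, which is smooth in x: the coefficient K of the
field K x with K = psi(t) / t up to scaling, where t = |x|^n.  The quotient by t
makes the divergence a multiple of psi'(t). *)
Definition profile (s : R) : R := profile_scale * (psi (W s) / W s).

Definition dprofile (s : R) : R :=
  profile_scale * (n%:R / (2 * s) * (dpsi (W s) - psi (W s) / W s)).

Let test_fun_small w : w <= q -> psi w = 0 /\ dpsi w = 0.
Proof.
have [_ _ _ [c [d [qc out]]]] := tf.
by move=> wq; apply: out; rewrite (le_trans wq (ltW qc)).
Qed.

Let near_small s : s <= 0 -> \forall y \near s, W y <= q.
Proof.
move=> s0; have : W y @[y --> s] --> W s by exact: continuous_W.
by move=> /cvgr_le; apply; rewrite W_le0.
Qed.

(** For s <= 0 the profile vanishes near s, since psi vanishes on (-oo, q] and q > 0. *)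
Lemma is_derive_profile s : is_derive s (1 : R) profile (dprofile s).
Proof.
have [s0|s0] := ltP 0 s; last first.
  have -> : dprofile s = 0.
    have [p0 d0] : psi (W s) = 0 /\ dpsi (W s) = 0.
      by apply: test_fun_small; rewrite W_le0// ltW.
    by rewrite /dprofile p0 d0 mul0r subrr !mulr0.
  apply: (@near_eq_is_derive _ _ _ (cst 0)).
  near=> y; have Wy : W y <= q by near: y; exact: near_small.
  by rewrite /profile (test_fun_small Wy).1 mul0r mulr0.
have [dp _ _ _] := tf.
have dW := is_derive_W s0; have w0 := W_gt0 s0.
have dpW := is_derive1_comp (dp (W s)) dW.
have w1 : W s != 0 by rewrite gt_eqF.
have dV := is_deriveV w1 dW.
have dP : is_derive s (1 : R) profile _ := is_deriveZ profile_scale (is_deriveM dpW dV).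
apply: (is_derive_eq dP); rewrite /GRing.scale /= /dprofile; field.
by rewrite w1 gt_eqF.
Unshelve. all: by end_near. Qed.

Lemma continuous_profile : continuous profile.
Proof.
move=> s; apply/differentiable_continuous/derivable1_diffP.
by have [] := is_derive_profile s.
Qed.

Lemma continuous_dprofile : continuous dprofile.
Proof.
move=> s; have [s0|s0] := ltP 0 s; last first.
  have E y : W y <= q -> dprofile y = 0.
    by move=> /test_fun_small[p0 d0]; rewrite /dprofile p0 d0 mul0r subrr !mulr0.
  rewrite /continuous_at (E s) ?(W_le0 s0) ?(ltW q_gt0)//.
  apply: cvg_near_cst.
  by near=> y; apply: E; near: y; exact: near_small.
have [dp cdp _ _] := tf.
have cp : continuous psi.
  by move=> x; apply/differentiable_continuous/derivable1_diffP; have [] := dp x.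
have w1 : W s != 0 by rewrite gt_eqF// W_gt0.
apply: cvgM; first exact: cvg_cst.
apply: cvgM.
  apply: cvgM; first exact: cvg_cst.
  apply: cvgV; first by rewrite mulf_neq0// gt_eqF.
  by apply: cvgM; [exact: cvg_cst|exact: cvg_id].
apply: cvgB; first by apply: (continuous_comp (@continuous_W s)); exact: cdp.
apply: cvgM; first by apply: (continuous_comp (@continuous_W s)); exact: cp.
by apply: cvgV => //; exact: continuous_W.
Unshelve. all: by end_near. Qed.

(** The left-hand side is the divergence of the field x |-> profile (|x|^2) x at
|x|^2 = s; the two occurrences of psi / t cancel. *)
Lemma profile_divergence s : 0 <= s ->
  2 * s * dprofile s + n%:R * profile s = profile_scale * n%:R * dpsi (W s).
Proof.
rewrite le_eqVlt => /predU1P[<-|s0].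
  have [p0 d0] : psi (W 0) = 0 /\ dpsi (W 0) = 0.
    by apply: test_fun_small; rewrite W_le0// ltW.
  by rewrite /profile p0 d0 mul0r !mulr0 mul0r add0r.
have w0 := W_gt0 s0.
by rewrite /dprofile /profile; field; rewrite !gt_eqF.
Qed.

(** If psi does not vanish at r^n then r^n > q, so the weight q^((n-1)/n) is at most
r^(n-1). *)
Lemma profile_bound r : 0 <= r -> `|profile (r ^+ 2)| * r <= 1.
Proof.
move=> r0; have Wr : W (r ^+ 2) = r ^+ n by rewrite /W sqrtr_sqr ger0_norm.
rewrite /profile Wr.
have [wq|qw] := leP (r ^+ n) q.
  by rewrite (test_fun_small wq).1 mul0r mulr0 normr0 mul0r ler01.
have rt0 := nth_root_gt0 n q_gt0.
have rtr : nth_root n q < r.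
  by rewrite -(ltr_pXn2r n_gt0) ?nnegrE ?(ltW rt0)// nth_rootK.
have r1 : 0 < r by exact: lt_trans rtr.
have [_ _ psi1 _] := tf.
have ps0 : 0 <= profile_scale by rewrite exprn_ge0 ?(ltW rt0).
rewrite normrM (ger0_norm ps0) normrM normfV (ger0_norm (exprn_ge0 n r0)).
have rn : r ^+ n = r * r ^+ n.-1 by rewrite -exprS prednK.
have := psi1 (r ^+ n); have : 0 <= `|psi (r ^+ n)| by [].
move: `|psi _| => p p0 p1; rewrite rn.
have -> : profile_scale * (p / (r * r ^+ n.-1)) * r = p * (profile_scale / r ^+ n.-1).
  by field; rewrite !gt_eqF// exprn_gt0.
rewrite mulr_ile1// ?divr_ge0 ?exprn_ge0 ?(ltW rt0)//.
rewrite ler_pdivrMr ?exprn_gt0// mul1r /profile_scale.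
by apply: lerXn2r; rewrite ?nnegrE ?(ltW rt0)// ltW.
Qed.

End radial_profile.

(** Reduces a directional derivative to a derivative in one variable. *)
Lemma is_derive_line (R : realType) (V W : normedModType R) (f : V -> W) (x v : V) (d : W) :
  is_derive (0 : R) (1 : R) (fun h : R => f (h *: v + x)) d -> is_derive x v f d.
Proof.
have E : (fun h : R => h^-1 *: (((fun k : R => f (k *: v + x)) \o shift 0) (h *: (1 : R)) -
    f ((0 : R) *: v + x))) = (fun h : R => h^-1 *: ((f \o shift x) (h *: v) - f x)).
  apply/funext => h; have h1 : h *: (1 : R) = h by exact: mulr1.
  by rewrite /= h1 addr0 scale0r add0r.
move=> [dg gd]; apply: DeriveDef.
  by move: dg; rewrite /derivable E.
by move: gd; rewrite /derive E.
Qed.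

Section radial_field.
Context {R : realType} (n : nat) (n_gt0 : (0 < n)%N).
Variables (q : R) (psi dpsi : R -> R).
Hypotheses (q_gt0 : 0 < q) (tf : test_fun q psi dpsi).
Implicit Types x y : 'rV[R]_n.
Local Notation k := (profile n q psi).
Local Notation dk := (dprofile n q psi dpsi).
Local Notation rv := (@radial_volume R n).

Definition radial_field x : 'rV[R]_n := k (enorm x ^+ 2) *: x.

Let partial (i j : 'I_n) x : R :=
  dk (enorm x ^+ 2) * (2 * x ord0 j) * x ord0 i + k (enorm x ^+ 2) * (i == j)%:R.

Lemma sqr_enorm_line x (j : 'I_n) (h : R) :
  enorm (h *: delta_mx 0 j + x) ^+ 2 = enorm x ^+ 2 + (2 * x ord0 j) * h + h ^+ 2.
Proof.
rewrite !sqr_enorm (bigD1 j)//= [in RHS](bigD1 j)//= !mxE !eqxx/= mulr1.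
rewrite (eq_bigr (fun i => x ord0 i ^+ 2)); first by ring.
by move=> i ij; rewrite !mxE (negbTE ij) andbF mulr0 add0r.
Qed.

Lemma is_derive_radial_field x (i j : 'I_n) :
  is_derive x (delta_mx 0 j : 'rV[R]_n) (fun y => radial_field y ord0 i) (partial i j x).
Proof.
apply: is_derive_line.
pose p (h : R) : R := enorm x ^+ 2 + (2 * x ord0 j) * h + h ^+ 2.
pose l (h : R) : R := h * (i == j)%:R + x ord0 i.
rewrite (_ : (fun h : R => _) = (k \o p) * l); last first.
  by apply/funext => h; rewrite /radial_field mxE sqr_enorm_line !mxE.
have dp : is_derive (0 : R) (1 : R) p (2 * x ord0 j).
  apply: (@is_derive_quadratic _ _ _ _ 1) => h; rewrite /p !add0r mul1r.
  rewrite (_ : _ - _ = h ^+ 2); last by ring.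
  by rewrite ger0_norm ?sqr_ge0.
have dl : is_derive (0 : R) (1 : R) l ((i == j)%:R).
  apply: (@is_derive_quadratic _ _ _ _ 0) => h; rewrite /l !add0r mul0r.
  rewrite (_ : _ - _ = 0); last by ring.
  by rewrite normr0 mul0r.
have p0 : p 0 = enorm x ^+ 2 by rewrite /p mulr0 expr0n/= !addr0.
have dkp := is_derive1_comp (is_derive_profile n_gt0 q_gt0 tf (p 0)) dp.
apply: (is_derive_eq (is_deriveM dkp dl)).
by rewrite /GRing.scale /= p0 /l /partial mul0r add0r; ring.
Qed.

Lemma continuous_sqr_enorm : continuous (fun x : 'rV[R]_n => enorm x ^+ 2).
Proof.
rewrite (_ : (fun x => _) = (fun x => \sum_i x ord0 i ^+ 2)); last first.
  by apply/funext => x; rewrite sqr_enorm.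
apply: continuous_big => [|i _ x]; first exact: add_continuous.
apply: (@continuous_comp _ _ _ (fun y : 'rV[R]_n => y ord0 i) (fun t => t ^+ 2)).
  exact: coord_continuous.
exact: exprn_continuous.
Qed.

(** The support lies in a cube, outside of which |x|^n exceeds the right end of the
support of psi. *)
Lemma radial_field_C1c : C1c_field radial_field.
Proof.
split.
  move=> i j; split => [x|]; first by have [] := is_derive_radial_field x i j.
  have -> : (fun x => 'D_(delta_mx 0 j) (fun y => radial_field y ord0 i) x) = partial i j.
    by apply/funext => x; have [] := is_derive_radial_field x i j.
  have ck : continuous (fun y : 'rV[R]_n => k (enorm y ^+ 2)).
    move=> x; apply: (continuous_comp (@continuous_sqr_enorm x)).
    exact: (continuous_profile n_gt0 q_gt0 tf).
  have cdk : continuous (fun y : 'rV[R]_n => dk (enorm y ^+ 2)).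
    move=> x; apply: (continuous_comp (@continuous_sqr_enorm x)).
    exact: (continuous_dprofile n_gt0 q_gt0 tf).
  have cc l : continuous (fun y : 'rV[R]_n => y ord0 l) by exact: coord_continuous.
  move=> x; have F : Filter (nbhs x) by exact: nbhs_filter.
  have h1 : (fun y : 'rV[R]_n => 2 * y ord0 j) @ x --> 2 * x ord0 j.
    by apply: cvgM; [exact: cvg_cst|exact: cc].
  have h2 : (fun y => dk (enorm y ^+ 2) * (2 * y ord0 j) * y ord0 i) @ x -->
      dk (enorm x ^+ 2) * (2 * x ord0 j) * x ord0 i.
    by apply: cvgM; [apply: cvgM; [exact: cdk|exact: h1]|exact: cc].
  have h3 : (fun y => k (enorm y ^+ 2) * (i == j)%:R) @ x -->
      k (enorm x ^+ 2) * (i == j)%:R.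
    by apply: cvgM; [exact: ck|exact: cvg_cst].
  have h4 : (fun y => dk (enorm y ^+ 2) * (2 * y ord0 j) * y ord0 i
      + k (enorm y ^+ 2) * (i == j)%:R) @ x --> partial i j x.
    by apply: cvgD; [exact: h2|exact: h3].
  exact: h4.
have [_ _ _ [c [d [_ out]]]] := tf.
pose D := Num.max 1 d.
pose K := [set x : 'rV[R]_n | forall i, `[- D, D]%classic (x ord0 i)].
have cK : compact K.
  exact: (@rV_compact _ n (fun=> `[- D, D]%classic) (fun=> @segment_compact _ _ _)).
apply: (subclosed_compact _ cK); first exact: closed_closure.
have hK : closed K.
  by apply: compact_closed => //; exact: norm_hausdorff.
rewrite [X in _ `<=` X](closure_id _).1//; apply: closure_subset => x /=.
apply: contraNP => xK; apply/eqP.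
have Dx : D < enorm x.
  rewrite ltNge; apply/negP => xD; apply: xK => i.
  by rewrite /= in_itv/= -ler_norml (le_trans (coord_le_enorm x i)).
have x1 : 1 <= enorm x by rewrite (le_trans _ (ltW Dx))// le_max lexx.
have dx : d <= enorm x ^+ n.
  rewrite (@le_trans _ _ (enorm x))//.
    by rewrite (le_trans _ (ltW Dx))// le_max lexx orbT.
  by rewrite -[leLHS]expr1 ler_weXn2l.
rewrite /radial_field /profile sqrtr_sqr ger0_norm ?enorm_ge0//.
have [-> _] := out (enorm x ^+ n) ltac:(by rewrite dx orbT).
by apply/funext => i; apply/funext => l; rewrite mul0r mulr0 scale0r mxE.
Qed.

Lemma radial_field_le1 x : enorm (radial_field x) <= 1.
Proof.
by rewrite /radial_field enormZ; apply: (profile_bound n_gt0 q_gt0 tf); exact: enorm_ge0.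
Qed.

Lemma divergence_radial_field x :
  divergence radial_field x = profile_scale n q * n%:R * dpsi (rv x).
Proof.
rewrite /divergence (eq_bigr (fun i => partial i i x)); last first.
  by move=> i _; have [] := is_derive_radial_field x i i.
rewrite /partial big_split/=.
under eq_bigr do rewrite -mulrA -mulrA -expr2.
rewrite -mulr_sumr -mulr_sumr -sqr_enorm.
under eq_bigr do rewrite eqxx mulr1.
rewrite sumr_const card_ord -[k _ *+ n]mulr_natl.
have := profile_divergence n_gt0 q_gt0 tf (sqr_ge0 (enorm x)).
rewrite sqrtr_sqr ger0_norm ?enorm_ge0// => <-.
by ring.
Qed.

End radial_field.

(** * The variation of a radial function controls that of its profile *)

Section duality.
Context {R : realType} (n : nat) (n_gt0 : (0 < n)%N).
Local Notation leb := (@lebesgue_measure R).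
Local Notation mu := (@lebesgue_rV R n).
Local Notation rv := (@radial_volume R n).

(** Test the variation of [u] against the radial field built from psi and
integrate in the volume coordinate. *)
Lemma dual_values_variation (u : 'rV[R]_n -> R) (G : R -> R) (q V : R) :
  0 < q -> measurable_fun setT u -> leb.-integrable setT (EFin \o G) ->
  (forall t, t <= 0 -> G t = 0) -> {ae mu, forall x, u x = G (rv x)} ->
  (bv_variation u <= V%:E)%E ->
  ubound (dual_values G q)
    (V / (@unit_volume R n * n%:R * profile_scale n q)).
Proof.
move=> q0 mu_ iG GN uG uV _ [[psi dpsi] /= tf <-].
have w0 := @unit_volume_gt0 R n n_gt0.
have s0 : 0 < profile_scale n q by rewrite exprn_gt0// nth_root_gt0.
have n0 : 0 < n%:R :> R by rewrite ltr0n.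
have itf := test_fun_integrable iG tf.
rewrite ler_pdivlMr ?mulr_gt0// -lee_fin; apply: le_trans uV.
apply: ereal_sup_ubound; exists (radial_field q psi).
  split; first exact: (radial_field_C1c n_gt0 q0 tf).
  by move=> x; exact: (radial_field_le1 n_gt0 q0 tf).
have [_ cd _ _] := tf.
have md : measurable_fun setT (dpsi : measurableTypeR R -> R).
  exact: continuous_measurable_fun.
have mG : measurable_fun setT (G : measurableTypeR R -> R).
  by have /integrableP[/measurable_EFinP] := iG.
under eq_integral do rewrite (divergence_radial_field n_gt0 q0 tf).
transitivity (\int[mu]_x (G (rv x) * dpsi (rv x) * (profile_scale n q * n%:R))%:E)%E.
  apply: ae_eq_integral => //.
  - apply/measurable_EFinP; apply: measurable_funM => //; apply: measurable_funM => //.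
    by apply: (measurableT_comp md); exact: measurable_radial_volume.
  - apply/measurable_EFinP; apply: measurable_funM => //; apply: measurable_funM => //.
      by apply: (measurableT_comp mG); exact: measurable_radial_volume.
    by apply: (measurableT_comp md); exact: measurable_radial_volume.
  - by apply: filterS uG => x -> _; congr EFin; ring.
rewrite (@Rintegral_radial R n n_gt0 (fun t => G t * dpsi t * (profile_scale n q * n%:R))).
- by rewrite RintegralZr//; congr EFin; ring.
- by have := integrableZr measurableT (profile_scale n q * n%:R) itf.
- by move=> t t0; rewrite GN// !mul0r.
Qed.

End duality.

(** * Functions with power decay *)

Section power_integral.
Context {R : realType}.
Local Notation leb := (@lebesgue_measure R).

Lemma integral_powRN_le (s e T : R) : s < 1 -> 0 < e -> e < T ->
  (\int[leb]_(t in `]e, T]) (t `^ (- s))%:E <= (T `^ (1 - s) / (1 - s))%:E)%E.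
Proof.
move=> s1 e0 eT; have s10 : 0 < 1 - s by lra.
have d (x : R) : 0 < x -> is_derive x (1 : R)
    (fun t => (1 - s)^-1 * t `^ (1 - s)) (x `^ (- s)).
  move=> x0; have dp := is_deriveZ (1 - s)^-1 (is_derive1_powR (1 - s) x0).
  apply: (is_derive_eq dp); rewrite /GRing.scale /= mulKf ?gt_eqF//.
  by congr (_ `^ _); ring.
have c (x : R) : 0 < x -> {for x, continuous (fun t : R => t `^ (- s))}.
  move=> x0; apply/differentiable_continuous/derivable1_diffP.
  by have [] := is_derive1_powR (- s) x0.
have cF (x : R) : 0 < x -> {for x, continuous (fun t => (1 - s)^-1 * t `^ (1 - s))}.
  move=> x0; apply/differentiable_continuous/derivable1_diffP.
  by have [] := d _ x0.
rewrite integral_itv_obnd_cbnd; last first.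
  by apply/measurable_EFinP; apply: measurable_funTS; exact: measurable_powR.
rewrite (@continuous_FTC2 _ _ (fun t => (1 - s)^-1 * t `^ (1 - s)))//.
- rewrite -EFinB lee_fin mulrC lerBlDr lerDl mulr_ge0 ?powR_ge0// invr_ge0 ltW//.
- apply/continuous_within_itvP => //; split.
  + by move=> x; rewrite in_itv/= => /andP[ex _]; apply: c; lra.
  + by apply: cvg_at_right_filter; exact: c.
  + by apply: cvg_at_left_filter; apply: c; lra.
- split.
  + by move=> x; rewrite in_itv/= => /andP[ex _]; have [] := d x ltac:(lra).
  + by apply: cvg_at_right_filter; exact: cF.
  + by apply: cvg_at_left_filter; apply: cF; lra.
- move=> x; rewrite in_itv/= => /andP[ex _]; rewrite derive1E.
  by have [] := d x ltac:(lra).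
Qed.

Lemma integrable_powRN (s T : R) : s < 1 -> 0 < T ->
  leb.-integrable `]0, T] (fun t => (t `^ (- s))%:E).
Proof.
move=> s1 T0.
have mp : measurable_fun setT (fun t : measurableTypeR R => (t `^ (- s))%:E).
  by apply/measurable_EFinP; exact: measurable_powR.
apply/integrableP; split; first exact: measurable_funTS.
pose F (i : nat) : set (measurableTypeR R) := `]T / i.+2%:R, T]%classic.
have UF : \bigcup_i F i = `]0, T]%classic.
  apply/seteqP; split => x.
    move=> [i _]; rewrite /F /= !in_itv/= => /andP[xi ->]; rewrite andbT.
    by apply: lt_trans xi; rewrite divr_gt0.
  rewrite /= in_itv/= => /andP[x0 xT].
  exists (Num.Def.archi_bound (T / x)) => //; rewrite /F /= in_itv/= xT andbT.
  rewrite ltr_pdivrMr// mulrC -ltr_pdivrMr//.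
  apply: (lt_le_trans (archi_boundP _)); first by rewrite divr_ge0// ltW.
  by rewrite ler_nat; apply: leqW.
have cv : (\int[leb]_(x in F i) `|(x `^ (- s))%:E|)%E @[i --> \oo] -->
    (\int[leb]_(x in `]0%R, T]) `|(x `^ (- s))%:E|)%E.
  rewrite -UF; apply: ge0_nondecreasing_set_cvg_integral => //.
  - move=> i j ij; apply/subsetPset => x; rewrite /F /= !in_itv/= => /andP[ix ->].
    rewrite andbT; apply: le_lt_trans ix; apply: ler_wpM2l; first exact: ltW.
    by rewrite lef_pV2 ?posrE// ler_nat !ltnS.
  - by move=> i; exact: measurable_itv.
  - by move=> i; apply: measurable_funTS;
      exact: (measurableT_comp (@abse_measurable R setT) mp).
rewrite -(cvg_lim _ cv)//.
apply: (@le_lt_trans _ _ (T `^ (1 - s) / (1 - s))%:E); last exact: ltry.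
apply: lime_le; first exact: cvgP cv.
apply: nearW => i.
under eq_integral do rewrite abse_EFin ger0_norm ?powR_ge0//.
apply: integral_powRN_le => //; first by rewrite divr_gt0.
by rewrite ltr_pdivrMr// ltr_pMr// ltr1n.
Qed.

End power_integral.

Section decaying.
Context {R : realType}.
Variables (a q : R).
Hypotheses (a_gt0 : 0 < a) (q_gt1 : 1 < q) (aq_lt1 : a * q < 1).
Local Notation leb := (@lebesgue_measure R).

(** What the L^q estimates use of a radial profile, and what is stable under almost
everywhere limits. *)
Definition decaying (A B : R) (G : R -> R) : Prop :=
  [/\ measurable_fun setT (G : measurableTypeR R -> R),
      forall t, t <= 0 -> G t = 0,
      {ae leb, forall t, 0 < t -> `|G t| <= A * t `^ (- a)} &
      (\int[leb]_t `|G t|%:E <= B%:E)%E].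

Let q_gt0 : 0 < q. Proof. exact: lt_trans q_gt1. Qed.

Lemma measurable_normr_powR (G : R -> R) :
  measurable_fun setT (G : measurableTypeR R -> R) ->
  measurable_fun setT (fun t : measurableTypeR R => (`|G t| `^ q)%:E).
Proof.
move=> mG; apply/measurable_EFinP; apply: (measurableT_comp (measurable_powR q)).
exact: (measurableT_comp (@normr_measurable R setT)).
Qed.

Lemma integral_split_pos (f : R -> \bar R) (T : R) :
  measurable_fun setT (f : measurableTypeR R -> \bar R) -> (forall t, 0 <= f t)%E ->
  (forall t, t <= 0 -> f t = 0%E) -> 0 < T ->
  (\int[leb]_t f t =
   \int[leb]_(t in `]0%R, T]) f t + \int[leb]_(t in `]T, +oo[) f t)%E.
Proof.
move=> mf f0 fN T0.
have -> : (\int[leb]_t f t = \int[leb]_(t in `]0%R, +oo[) f t)%E.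
  rewrite [RHS]integral_mkcond; apply: eq_integral => t _; rewrite patchE; case: ifPn => //.
  by rewrite notin_setE /= in_itv/= andbT => /negP; rewrite -leNgt => /fN.
have -> : `]0, +oo[%classic = `]0, T]%classic `|` `]T, +oo[%classic.
  apply/seteqP; split => t /=; rewrite !in_itv/= !andbT.
    by move=> t0; have [tT|Tt] := leP t T; [left; rewrite t0|right].
  by move=> [/andP[]//|Tt]; exact: lt_trans Tt.
rewrite ge0_integral_setU//; first exact: measurable_funTS.
apply/disj_setPS => t []; rewrite /= !in_itv/= andbT => /andP[_ tT] Tt; lra.
Qed.

(** Interpolate: all but one of the q powers of |G| are estimated by the decay. *)
Lemma decaying_powR (A T t G : R) : 0 <= A -> 0 < T -> T <= t ->
  `|G| <= A * t `^ (- a) -> `|G| `^ q <= (A * T `^ (- a)) `^ (q - 1) * `|G|.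
Proof.
move=> A0 T0 Tt Gt; rewrite -mulr_powRB1// mulrC; apply: ler_wpM2r => //.
have q10 : 0 <= q - 1 by rewrite subr_ge0 ltW.
apply: (ge0_ler_powR q10); rewrite ?nnegrE ?mulr_ge0 ?powR_ge0//.
apply: (le_trans Gt); apply: ler_wpM2l => //; rewrite !powRN.
rewrite lef_pV2 ?posrE ?powR_gt0//; last exact: lt_le_trans Tt.
by apply: (ge0_ler_powR (ltW a_gt0)); rewrite ?nnegrE ?(ltW T0)// (le_trans (ltW T0)).
Qed.

Lemma decaying_tail A B G T : 0 <= A -> decaying A B G -> 0 < T ->
  (\int[leb]_(t in `]T, +oo[) (`|G t| `^ q)%:E <=
    ((A * T `^ (- a)) `^ (q - 1) * B)%:E)%E.
Proof.
move=> A0 [mG GN Ga GB] T0.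
have mn : measurable_fun setT (fun t : measurableTypeR R => `|G t|%:E).
  by apply/measurable_EFinP; exact: (measurableT_comp (@normr_measurable R setT)).
set c := (A * T `^ (- a)) `^ (q - 1).
have c0 : 0 <= c by exact: powR_ge0.
apply: (@le_trans _ _ (\int[leb]_(t in `]T, +oo[) (c%:E * `|G t|%:E))%E).
  apply: ae_ge0_le_integral => //.
  - by apply: measurable_funTS; exact: measurable_normr_powR.
  - by move=> t _; rewrite mule_ge0.
  - by apply: measurable_funTS; apply: measurable_funeM.
  apply: filterS Ga; first exact: (ae_filter_ringOfSetsType leb).
  move=> t Gt; rewrite /= in_itv/= andbT => Tt; rewrite -EFinM lee_fin.
  by apply: (decaying_powR A0 T0 (ltW Tt)); apply: Gt; exact: lt_trans Tt.
rewrite ge0_integralZl//; last exact: measurable_funTS.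
rewrite EFinM; apply: lee_wpmul2l => //; apply: le_trans GB.
by apply: ge0_subset_integral.
Qed.

(** Finite because a q < 1. *)
Definition head_mass : R := fine (\int[leb]_(t in `]0%R, 1%R]) (t `^ (- (a * q)))%:E)%E.

Lemma head_mass_ge0 : 0 <= head_mass.
Proof. by rewrite fine_ge0// integral_ge0// => t _; rewrite lee_fin powR_ge0. Qed.

Lemma powR_decay A t : 0 <= A -> 0 < t ->
  (A * t `^ (- a)) `^ q = A `^ q * t `^ (- (a * q)).
Proof.
by move=> A0 t0; rewrite powRM ?powR_ge0// -powRrM mulNr.
Qed.

(** Near 0 the decay is q-integrable; on (1, +oo) interpolate with the L^1 bound. *)
Lemma decaying_Lq A B G : 0 <= A -> decaying A B G ->
  (\int[leb]_t (`|G t| `^ q)%:E <= (A `^ q * head_mass + A `^ (q - 1) * B)%:E)%E.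
Proof.
move=> A0 dG; have [mG GN Ga GB] := dG.
have mq := measurable_normr_powR mG.
rewrite (@integral_split_pos _ 1)//; last first.
  by move=> t t0; rewrite GN// normr0 powR0// gt_eqF.
rewrite EFinD; apply: leeD; last first.
  by have := decaying_tail A0 dG ltr01; rewrite powR1 mulr1.
have ip := integrable_powRN aq_lt1 (@ltr01 R).
have mp : measurable_fun setT (fun t : measurableTypeR R => (t `^ (- (a * q)))%:E).
  by apply/measurable_EFinP; exact: measurable_powR.
apply: (@le_trans _ _ (\int[leb]_(t in `]0%R, 1%R])
    ((A `^ q)%:E * (t `^ (- (a * q)))%:E))%E).
  apply: ae_ge0_le_integral => //.
  - exact: measurable_funTS.
  - by move=> t _; rewrite mule_ge0// lee_fin powR_ge0.
  - by apply: measurable_funTS; apply: measurable_funeM.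
  apply: filterS Ga; first exact: (ae_filter_ringOfSetsType leb).
  move=> t Gt; rewrite /= in_itv/= => /andP[t0 t1]; rewrite -EFinM lee_fin.
  rewrite -powR_decay//; apply: (ge0_ler_powR (ltW q_gt0));
    rewrite ?nnegrE ?mulr_ge0 ?powR_ge0//.
  exact: Gt.
rewrite ge0_integralZl//; last 2 first.
- by move=> t _; rewrite lee_fin powR_ge0.
- by rewrite lee_fin powR_ge0.
rewrite EFinM /head_mass fineK//.
- by apply: integrable_fin_num ip.
exact: measurable_funTS.
Qed.

(** Dominated convergence on (0, T], for a T beyond which the tails are
uniformly small. *)
Lemma decaying_vanish A B (D : nat -> R -> R) (e : R) : 0 <= A -> 0 <= B -> 0 < e ->
  (forall n, decaying A B (D n)) ->
  {ae leb, forall t, 0 < t -> D n t @[n --> \oo] --> 0} ->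
  \forall n \near \oo, (\int[leb]_t (`|D n t| `^ q)%:E <= e%:E)%E.
Proof.
move=> A0 B0 e0 dD D0.
have q10 : 0 < q - 1 by rewrite subr_gt0.
have aq0 : 0 < a * (q - 1) by rewrite mulr_gt0.
(* T is chosen so that T^(a (q - 1)) = X, which bounds the tails by e / 2 *)
pose X := A `^ (q - 1) * B / (e / 2) + 1.
have X0 : 0 < X by rewrite ltr_wpDl// divr_ge0 ?mulr_ge0 ?powR_ge0// ltW// divr_gt0.
pose T := X `^ (a * (q - 1))^-1.
have T0 : 0 < T by exact: powR_gt0.
have tail n : (\int[leb]_(t in `]T, +oo[) (`|D n t| `^ q)%:E <= (e / 2)%:E)%E.
  apply: (le_trans (decaying_tail A0 (dD n) T0)); rewrite lee_fin.
  rewrite powRM ?powR_ge0// /T -!powRrM.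
  have -> : (a * (q - 1))^-1 * (- a * (q - 1)) = - 1 by field; rewrite !gt_eqF.
  rewrite powR_inv1 ?(ltW X0)// mulrAC ler_pdivrMr// -ler_pdivrMl ?divr_gt0// mulrC.
  by rewrite /X lerDl.
have mD n := let: And4 m _ _ _ := dD n in m.
have head : (\int[leb]_(t in `]0%R, T]) (`|D n t| `^ q)%:E)%E @[n --> \oo] --> 0%E.
  have := @dominated_convergence _ _ R leb `]0, T]%classic (measurable_itv _)
    (fun n t => (`|D n t| `^ q)%:E) (cst 0%E)
    (fun t => (A `^ q)%:E * (t `^ (- (a * q)))%:E)%E.
  rewrite integral0 => -[] //.
  - by move=> n; apply: measurable_funTS; exact: measurable_normr_powR.
  - apply: filterS D0; first exact: (ae_filter_ringOfSetsType leb).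
    move=> t Dt; rewrite /= in_itv/= => /andP[t0 _].
    apply/fine_cvgP; split; first exact: nearW.
    apply/cvgrPdist_lt => d d0.
    have dq : 0 < d `^ q^-1 by exact: powR_gt0.
    have := Dt t0 => /cvgrPdist_lt /(_ _ dq); apply: filterS => n; rewrite !sub0r !normrN.
    move=> h; rewrite /= ger0_norm ?powR_ge0//.
    have -> : d = (d `^ q^-1) `^ q by rewrite -powRrM mulVf ?powRr1 ?(ltW d0)// gt_eqF.
    by apply: gt0_ltr_powR; rewrite ?nnegrE ?powR_ge0.
  - by apply: integrableZl => //; apply: integrable_powRN.
  - have Dall : {ae leb, forall t, forall n, 0 < t -> `|D n t| <= A * t `^ (- a)}.
      by apply/ae_foralln => n; have [] := dD n.
    apply: filterS Dall; first exact: (ae_filter_ringOfSetsType leb).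
    move=> t Dt n; rewrite /= in_itv/= => /andP[t0 _].
    rewrite -EFinM lee_fin ger0_norm ?powR_ge0// -powR_decay//.
    apply: (ge0_ler_powR (ltW q_gt0)); rewrite ?nnegrE ?mulr_ge0 ?powR_ge0//.
    exact: Dt.
have e20 : 0 < e / 2 by rewrite divr_gt0.
move/fine_cvgP : head => [hfin /cvgrPdist_le /(_ _ e20)] h.
near=> n; rewrite (@integral_split_pos _ T)//.
- have -> : e = e / 2 + e / 2 by field.
  rewrite EFinD; apply: leeD; last exact: tail.
  have fn : (\int[leb]_(t in `]0%R, T]) (`|D n t| `^ q)%:E)%E \is a fin_num by near: n.
  rewrite -(fineK fn) lee_fin (le_trans (ler_norm _))//.
  by rewrite -normrN -sub0r; near: n.
- exact: measurable_normr_powR.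
- by move=> t t0; have [_ DN _ _] := dD n; rewrite DN// normr0 powR0// gt_eqF.
Unshelve. all: by end_near. Qed.

(** The upper limit is a measurable version of the limit; Fatou's lemma gives its
L^1 bound. *)
Lemma decaying_lim A B (G : nat -> R -> R) : (forall n, decaying A B (G n)) ->
  {ae leb, forall t, 0 < t -> cvgn (fun n => G n t)} ->
  exists Gl, decaying A B Gl /\
    {ae leb, forall t, 0 < t -> G n t @[n --> \oo] --> Gl t}.
Proof.
move=> dG cG.
pose Gl t := if 0 < t then fine (limn_esup (fun n => (G n t)%:E)) else 0.
have GlE : {ae leb, forall t, 0 < t -> G n t @[n --> \oo] --> Gl t}.
  apply: filterS cG; first exact: (ae_filter_ringOfSetsType leb).
  move=> t Gt t0; have /cvg_ex[l hl] := Gt t0.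
  have hl' : (G n t)%:E @[n --> \oo] --> l%:E by apply: cvg_EFin => //; exact: nearW.
  rewrite /Gl t0 is_cvg_limn_esupE; last by apply/cvg_ex; exists l%:E.
  by rewrite (cvg_lim _ hl').
have mGl : measurable_fun setT (Gl : measurableTypeR R -> R).
  rewrite (_ : Gl = (fun t => fine (limn_esup (fun n => (G n t)%:E))) \_ `]0, +oo[);
    last first.
    apply/funext => t; rewrite /Gl patchE; case: ifPn => t0.
      by rewrite mem_set//= in_itv/= t0.
    by rewrite memNset//= in_itv/= (negbTE t0).
  apply/(measurable_restrictT _ (measurable_itv _)); apply: measurable_funTS.
  apply: measurableT_comp => //.
  apply: measurable_fun_limn_esup => n; apply/measurable_EFinP.
  by have [] := dG n.
exists Gl; split => //; split => //.
- by move=> t t0; rewrite /Gl ltNge t0.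
- have Gall : {ae leb, forall t, forall n, 0 < t -> `|G n t| <= A * t `^ (- a)}.
    by apply/ae_foralln => n; have [] := dG n.
  apply: filterS2 GlE Gall; first exact: (ae_filter_ringOfSetsType leb).
  move=> t Gt Gb t0.
  have h : `|G n t| @[n --> \oo] --> `|Gl t| by apply: cvg_norm; exact: Gt.
  have cb : (fun=> A * t `^ (- a)) @ \oo --> A * t `^ (- a) by exact: cvg_cst.
  by apply: (ler_cvg_to h cb); apply: nearW => n; exact: Gb.
have mn n : measurable_fun setT (fun t : measurableTypeR R => `|G n t|%:E).
  apply/measurable_EFinP; apply: (measurableT_comp (@normr_measurable R setT)).
  by have [] := dG n.
apply: (@le_trans _ _ (\int[leb]_t limn_einf (fun n => `|G n t|%:E))%E).
  apply: ae_ge0_le_integral => //.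
  - by apply/measurable_EFinP; exact: (measurableT_comp (@normr_measurable R setT)).
  - move=> t _; rewrite limn_einf_lim; apply: lime_ge; first exact: is_cvg_einfs.
    by apply: nearW => n; apply: le_ereal_inf_tmp => _ [m _ <-]; rewrite lee_fin.
  - apply: (emeasurable_fun_cvg (fun n t => einfs (fun m => `|G m t|%:E) n)).
      by move=> n; apply: measurable_fun_einfs.
    by move=> t _; rewrite limn_einf_lim; exact: is_cvg_einfs.
  apply: filterS GlE; first exact: (ae_filter_ringOfSetsType leb).
  move=> t Gt _; have [t0|t0] := ltP 0 t.
    have h : `|G n t|%:E @[n --> \oo] --> `|Gl t|%:E.
      by apply: cvg_EFin; [exact: nearW|apply: cvg_norm; exact: Gt].
    by rewrite limn_einf_lim (cvg_lim _ (cvg_einfs h)).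
  rewrite /Gl ltNge t0 /= normr0 limn_einf_lim; apply: lime_ge; first exact: is_cvg_einfs.
  by apply: nearW => n; apply: le_ereal_inf_tmp => _ [m _ <-]; rewrite lee_fin.
apply: (le_trans (fatou leb measurableT mn _)) => //.
rewrite limn_einf_lim; apply: lime_le; first exact: is_cvg_einfs.
apply: nearW => n; apply: ereal_inf_le.
exists (\int[leb]_t `|G n t|%:E)%E; first by exists n => /=.
by have [] := dG n.
Qed.

Lemma decayingB A B A' B' G H : decaying A B G -> decaying A' B' H ->
  decaying (A + A') (B + B') (fun t => G t - H t).
Proof.
move=> [mG GN Ga GB] [mH HN Ha HB]; split.
- exact: measurable_funB.
- by move=> t t0; rewrite GN// HN// subrr.
- apply: filterS2 Ga Ha; first exact: (ae_filter_ringOfSetsType leb).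
  move=> t Gt Ht t0; rewrite mulrDl; apply: (le_trans (ler_normB _ _)).
  by apply: lerD; [exact: Gt|exact: Ht].
have mn (F : R -> R) : measurable_fun setT (F : measurableTypeR R -> R) ->
    measurable_fun setT (fun t : measurableTypeR R => `|F t|%:E).
  by move=> mF; apply/measurable_EFinP; exact: (measurableT_comp (@normr_measurable R setT)).
rewrite EFinD; apply: le_trans (leeD GB HB).
rewrite -ge0_integralD//; [|exact: mn|exact: mn].
apply: ge0_le_integral => //.
- by apply: mn; exact: measurable_funB.
- by apply: emeasurable_funD; exact: mn.
- by move=> t _; rewrite -EFinD lee_fin ler_normB.
Qed.

End decaying.

(** * Norms of radial functions *)

Section radial_Lnorm.
Context {R : realType} (n : nat) (n_gt0 : (0 < n)%N).
Local Notation leb := (@lebesgue_measure R).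
Local Notation mu := (@lebesgue_rV R n).
Local Notation rv := (@radial_volume R n).
Local Notation omega := (@unit_volume R n).

Lemma integral_radial_powR (w : 'rV[R]_n -> R) (G : R -> R) (p : R) : 0 < p ->
  measurable_fun setT w -> measurable_fun setT (G : measurableTypeR R -> R) ->
  (forall t, t <= 0 -> G t = 0) -> {ae mu, forall x, w x = G (rv x)} ->
  (\int[mu]_x (`|w x| `^ p)%:E = omega%:E * \int[leb]_t (`|G t| `^ p)%:E)%E.
Proof.
move=> p0 mw mG GN wG.
have mGp := measurable_normr_powR p mG.
rewrite -ge0_integral_radialT//; last first.
  by move=> t t0; rewrite GN// normr0 powR0// gt_eqF.
apply: ae_eq_integral => //.
- apply/measurable_EFinP; apply: (measurableT_comp (measurable_powR p)).
  exact: (measurableT_comp (@normr_measurable R setT)).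
- by apply: (measurableT_comp mGp); exact: measurable_radial_volume.
- by apply: filterS wG => x ->.
Qed.

Lemma radial_Lnorm_le (w : 'rV[R]_n -> R) (G : R -> R) (p E : R) : 0 < p ->
  measurable_fun setT w -> measurable_fun setT (G : measurableTypeR R -> R) ->
  (forall t, t <= 0 -> G t = 0) -> {ae mu, forall x, w x = G (rv x)} ->
  (\int[leb]_t (`|G t| `^ p)%:E <= E%:E)%E ->
  ('N[mu]_p%:E[EFin \o w] <= ((omega * E) `^ p^-1)%:E)%E.
Proof.
move=> p0 mw mG GN wG GE.
rewrite unlock /Lnorm -poweR_EFin.
rewrite (eq_integral (fun x => (`|w x| `^ p)%:E)); last first.
  by move=> x _; rewrite -poweR_EFin.
have w0 := @unit_volume_gt0 R n n_gt0.
have le : (\int[mu]_x (`|w x| `^ p)%:E <= (omega * E)%:E)%E.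
  rewrite (integral_radial_powR p0 mw mG GN wG) EFinM.
  by apply: lee_wpmul2l => //; rewrite lee_fin ltW.
have i0 : (0 <= \int[mu]_x (`|w x| `^ p)%:E)%E.
  by apply: integral_ge0 => x _; rewrite lee_fin powR_ge0.
apply: gt0_ler_poweR => //; first by rewrite invr_ge0 ltW.
- by rewrite in_itv/= leey i0.
- by rewrite in_itv/= leey (le_trans i0 le).
Qed.

End radial_Lnorm.

(** * Profiles of radial functions of bounded variation *)

Section profile_of_BV_rad.
Context {R : realType} (n : nat) (n_gt0 : (0 < n)%N).
Local Notation leb := (@lebesgue_measure R).
Local Notation mu := (@lebesgue_rV R n).
Local Notation rv := (@radial_volume R n).
Local Notation omega := (@unit_volume R n).

Definition decay_exponent : R := n.-1%:R / n%:R.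

(** The factor 2^a comes from estimating G(t) by the variation on (t / 2, +oo). *)
Definition decay_constant : R := 2 `^ decay_exponent / (omega * n%:R).

(** The zero field is a competitor. *)
Lemma bv_variation_ge0 (u : 'rV[R]_n -> R) : (0 <= bv_variation u)%E.
Proof.
apply: ereal_sup_ubound; exists (radial_field 1 (cst 0)).
  split; first exact: (radial_field_C1c n_gt0 ltr01 (test_fun0 _)).
  by move=> x; exact: (radial_field_le1 n_gt0 ltr01 (test_fun0 _)).
under eq_integral do
  rewrite (divergence_radial_field n_gt0 ltr01 (test_fun0 _)) /= !mulr0.
by rewrite integral0.
Qed.

Lemma profile_scaleE (t : R) : profile_scale n t = t `^ decay_exponent.
Proof.
by rewrite /profile_scale /nth_root -powR_mulrn ?powR_ge0// -powRrM mulrC.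
Qed.

(** The variation bound on (t / 2, +oo) controls |G| at every Lebesgue point t. *)
Lemma BV_rad_profile (u : 'rV[R]_n -> R) (M : R) :
  BV_rad u -> (BV_norm u <= M%:E)%E ->
  exists G : R -> R,
    [/\ {ae mu, forall x, u x = G (rv x)}, leb.-integrable setT (EFin \o G),
        decaying decay_exponent (decay_constant * M) (M / omega) G &
        forall q, 0 < q ->
          ubound (dual_values G q) (M / (omega * n%:R * profile_scale n q))].
Proof.
move=> [[u1 _] [g ug]] uM.
have mu_ : measurable_fun setT u by have := sub_Lfun_mfun u1; rewrite inE.
have [G [mG GN uG]] := radial_representative n_gt0 mu_ ug.
have w0 := @unit_volume_gt0 R n n_gt0.
have n0 : 0 < n%:R :> R by rewrite ltr0n.
have uV : (bv_variation u <= M%:E)%E.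
  by apply: le_trans uM; rewrite leeDl// Lnorm_ge0.
have uL : ('N[mu]_1[EFin \o u] <= M%:E)%E.
  by apply: le_trans uM; rewrite leeDr// bv_variation_ge0.
have mn : measurable_fun setT (fun t : measurableTypeR R => `|G t|%:E).
  by apply/measurable_EFinP; exact: (measurableT_comp (@normr_measurable R setT)).
have GB : (\int[leb]_t `|G t|%:E <= (M / omega)%:E)%E.
  move: uL; rewrite Lnorm1.
  have -> : (\int[mu]_x `|(EFin \o u) x| = omega%:E * \int[leb]_t `|G t|%:E)%E.
    under eq_integral do rewrite /= -[`|u _|]powRr1//.
    rewrite (integral_radial_powR n_gt0 (ltr01) mu_ mG GN uG).
    by under eq_integral do rewrite powRr1//.
  by rewrite -lee_pdivlMl// -EFinM mulrC.
have iG : leb.-integrable setT (EFin \o G).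
  apply/integrableP; split; first exact/measurable_EFinP.
  exact: le_lt_trans GB (ltry _).
have ub q : 0 < q -> ubound (dual_values G q) (M / (omega * n%:R * profile_scale n q)).
  by move=> q0; exact: (dual_values_variation n_gt0 q0 mu_ iG GN uG uV).
exists G; split => //; split => //.
have locG : locally_integrable setT G.
  by apply: open_integrable_locally; [exact: openT|exact: iG].
have aeG := lebesgue_differentiation locG.
apply: filterS (aeG); first exact: (ae_filter_ringOfSetsType leb).
move=> t Gt t0; have t20 : 0 < t / 2 by rewrite divr_gt0.
have ubt := ub _ t20.
have tt : t / 2 < t by rewrite ltr_pdivrMr// ltr_pMr// ltr1n.
apply: (le_trans (abs_le_tail_variation iG ubt aeG tt Gt)).
apply: (le_trans (tail_variation_ub ubt)).
rewrite profile_scaleE powRM ?invr_ge0 ?(ltW t0)//.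
rewrite -[2^-1]powR_inv1// -powRrM mulN1r !powRN /decay_constant.
have ta : 0 < t `^ decay_exponent by exact: powR_gt0.
have t2 : 0 < 2 `^ decay_exponent :> R by exact: powR_gt0.
rewrite le_eqVlt; apply/orP; left; apply/eqP; field.
by rewrite !gt_eqF.
Qed.

End profile_of_BV_rad.

(** * The compact embedding *)

Section compact_embedding.
Context {R : realType} (n : nat) (n_gt1 : (1 < n)%N).
Variable q : R.
Hypotheses (q_gt1 : 1 < q) (q_lt : q < n%:R / (n%:R - 1)).
Local Notation leb := (@lebesgue_measure R).
Local Notation mu := (@lebesgue_rV R n).
Local Notation rv := (@radial_volume R n).
Local Notation omega := (@unit_volume R n).
Local Notation a := (@decay_exponent R n).
Local Notation c := (@decay_constant R n).

Let n_gt0 : (0 < n)%N. Proof. exact: ltnW. Qed.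

Let q_gt0 : 0 < q. Proof. exact: lt_trans q_gt1. Qed.

Let omega_gt0 : 0 < omega. Proof. exact: unit_volume_gt0. Qed.

Let c_gt0 : 0 < c.
Proof. by rewrite divr_gt0 ?powR_gt0// mulr_gt0// ltr0n. Qed.

Lemma decay_exponent_gt0 : 0 < a :> R.
Proof. by rewrite divr_gt0// ltr0n// -subn1 subn_gt0. Qed.

(** This is where q is required to be subcritical. *)
Lemma decay_exponent_lt : a * q < 1.
Proof.
have n0 : 0 < n%:R :> R by rewrite ltr0n.
have n1 : 0 < n%:R - 1 :> R by rewrite subr_gt0 ltr1n.
rewrite /decay_exponent -subn1 natrB// mulrAC ltr_pdivrMr// mul1r mulrC.
by rewrite -ltr_pdivlMr.
Qed.

Let a_gt0 := decay_exponent_gt0.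
Let aq_lt1 := decay_exponent_lt.

Lemma Lfun_intro (w : 'rV[R]_n -> R) :
  measurable_fun setT w -> ('N[mu]_q%:E[EFin \o w] < +oo)%E -> w \in Lfun mu q%:E.
Proof.
by move=> mw fw; rewrite inE; apply/andP; split; rewrite inE.
Qed.

Lemma BV_rad_measurable (u : 'rV[R]_n -> R) : BV_rad u -> measurable_fun setT u.
Proof. by move=> [[u1 _] _]; have := sub_Lfun_mfun u1; rewrite inE. Qed.

Lemma BV_norm_fin (u : 'rV[R]_n -> R) : BV_rad u ->
  exists2 M, 0 <= M & BV_norm u = M%:E.
Proof.
move=> [[u1 uV] _].
have N0 : (0 <= BV_norm u)%E by rewrite adde_ge0 ?Lnorm_ge0// bv_variation_ge0.
have fN : BV_norm u \is a fin_num.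
  rewrite ge0_fin_numE// lte_add_pinfty//.
  by have := sub_Lfun_finLfun u1; rewrite inE.
by exists (fine (BV_norm u)); [exact: fine_ge0|rewrite fineK].
Qed.

(** The q-th root of the bound of [decaying_Lq] for a function of norm 1, times the
Jacobian omega of the volume coordinate. *)
Definition embedding_constant : R :=
  (omega * (c `^ q * head_mass a q + c `^ (q - 1) / omega)) `^ q^-1.

(** The bound of [decaying_Lq] is homogeneous of degree q in the norm of u. *)
Lemma BV_rad_Lnorm_le (u : 'rV[R]_n -> R) : BV_rad u ->
  ('N[mu]_q%:E[EFin \o u] <= embedding_constant%:E * BV_norm u)%E.
Proof.
move=> uX; have [M M0 uM] := BV_norm_fin uX.
have [|G [uG _ dG _]] := @BV_rad_profile R n n_gt0 u M uX; first by rewrite uM.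
have [mG GN _ _] := dG.
have A0 : 0 <= c * M by rewrite mulr_ge0// ltW.
have := radial_Lnorm_le n_gt0 q_gt0 (BV_rad_measurable uX) mG GN uG
  (decaying_Lq a_gt0 q_gt1 aq_lt1 A0 dG).
rewrite uM -EFinM => /le_trans; apply; rewrite lee_fin le_eqVlt; apply/orP; left.
have Mq : M `^ (q - 1) * M = M `^ q by rewrite mulrC mulr_powRB1.
have -> : omega * ((c * M) `^ q * head_mass a q + (c * M) `^ (q - 1) * (M / omega)) =
    omega * (c `^ q * head_mass a q + c `^ (q - 1) / omega) * M `^ q.
  rewrite (powRM q (ltW c_gt0) M0) (powRM (q - 1) (ltW c_gt0) M0) -Mq; ring.
have E0 : 0 <= omega * (c `^ q * head_mass a q + c `^ (q - 1) / omega).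
  rewrite mulr_ge0 ?(ltW omega_gt0)// addr_ge0 ?mulr_ge0 ?powR_ge0 ?head_mass_ge0//.
  by rewrite invr_ge0 ltW.
rewrite (powRM q^-1 E0 (powR_ge0 M q)) -powRrM mulfV; last by rewrite gt_eqF.
by rewrite (powRr1 M0).
Qed.

Theorem BV_rad_compactly_embedded : compactly_embedded (@BV_rad R n) BV_norm q.
Proof.
split.
- move=> u uX; apply: Lfun_intro; first exact: BV_rad_measurable.
  apply: (le_lt_trans (BV_rad_Lnorm_le uX)).
  by have [M _ ->] := BV_norm_fin uX; rewrite -EFinM ltry.
- by exists embedding_constant => u; exact: BV_rad_Lnorm_le.
move=> u_ uX [M uM].
have M0 : 0 <= M.
  have [M' M'0 uE] := BV_norm_fin (uX 0%N).
  by have := uM 0%N; rewrite uE lee_fin; exact: le_trans.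
have A0 : 0 <= c * M by rewrite mulr_ge0// ltW.
have B0 : 0 <= M / omega by rewrite divr_ge0// ltW.
have /choice[G hG] := fun i => BV_rad_profile n_gt0 (uX i) (uM i).
pose K s : R := M / (omega * n%:R * profile_scale n s).
have iG i : leb.-integrable setT (EFin \o G i) by have [] := hG i.
have ubG i s : 0 < s -> ubound (dual_values (G i) s) (K s).
  by move=> s0; have [_ _ _ h] := hG i; exact: h.
have [k [kinc kcvg]] := helly iG ubG.
have dG i : decaying a (c * M) (M / omega) (G (k i)) by have [] := hG (k i).
have [Gl [dGl Glim]] := decaying_lim dG kcvg.
have [mGl GlN _ _] := dGl.
pose v x : R := Gl (rv x).
have mv : measurable_fun setT v.
  by apply: (measurableT_comp mGl); exact: measurable_radial_volume.
exists k, v; split => //.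
- apply: Lfun_intro => //.
  have vG : {ae mu, forall x, v x = Gl (rv x)} by exact: aeW.
  apply: (le_lt_trans (radial_Lnorm_le n_gt0 q_gt0 mv mGl GlN vG
    (decaying_Lq a_gt0 q_gt1 aq_lt1 A0 dGl))).
  exact: ltry.
pose D i t := G (k i) t - Gl t.
have dD i : decaying a (c * M + c * M) (M / omega + M / omega) (D i).
  exact: decayingB (dG i) dGl.
have D0 : {ae leb, forall t, 0 < t -> D i t @[i --> \oo] --> 0}.
  apply: filterS Glim; first exact: (ae_filter_ringOfSetsType leb).
  move=> t Gt t0; rewrite -(subrr (Gl t)).
  by apply: cvgB; [exact: Gt|exact: cvg_cst].
have wD i : {ae mu, forall x, (u_ (k i) \- v) x = D i (rv x)}.
  by have [uG _ _ _] := hG (k i); apply: filterS uG => x /= ->.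
have mw i : measurable_fun setT (u_ (k i) \- v).
  by apply: measurable_funB => //; exact: BV_rad_measurable.
have small (e : R) : 0 < e ->
    \forall i \near \oo, ('N[mu]_q%:E[EFin \o (u_ (k i) \- v)%R] <= e%:E)%E.
  move=> e0; have E0 : 0 < e `^ q / omega by rewrite divr_gt0// powR_gt0.
  have := decaying_vanish a_gt0 q_gt1 aq_lt1 (addr_ge0 A0 A0) (addr_ge0 B0 B0) E0 dD D0.
  apply: filterS => i Di; have [mDi DiN _ _] := dD i.
  have := radial_Lnorm_le n_gt0 q_gt0 (mw i) mDi DiN (wD i) Di.
  rewrite mulrC divfK ?gt_eqF// -powRrM mulfV ?gt_eqF// powRr1//; exact: ltW.
apply/fine_cvgP; split.
  have := small 1 ltr01; apply: filterS => i hi.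
  by rewrite ge0_fin_numE ?Lnorm_ge0// (le_lt_trans hi) ?ltry.
apply/cvgrPdist_le => e e0; have := small e e0; apply: filterS => i hi.
rewrite sub0r normrN ger0_norm ?fine_ge0 ?Lnorm_ge0//=.
have fi : 'N[mu]_q%:E[EFin \o (u_ (k i) \- v)%R]%E \is a fin_num.
  by rewrite ge0_fin_numE ?Lnorm_ge0// (le_lt_trans hi) ?ltry.
by rewrite -lee_fin fineK.
Qed.

End compact_embedding.

Theorem theorem1p2 (R : realType) (N : nat) (hN : (2 <= N)%N)
    (q : R) (hq1 : 1 < q) (hqN : q < N%:R / (N%:R - 1)) :
  compactly_embedded (@BV_rad R N) BV_norm q.
Proof. exact: BV_rad_compactly_embedded. Qed.
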